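(* Let $(M,g)$ be a pseudo-Riemannian manifold of dimension $n\ge2$ with Levi-Civita connection $\nabla$. (1) Let $B_\circ$ be a constant. Solutions $f$ of the Gallot–Obata–Tanno equation $$\nabla_a\nabla_b\nabla_cf+B_\circ\,(2g_{bc}\nabla_af+g_{ab}\nabla_cf+g_{ca}\nabla_bf)=0\qquad(\ast)$$ are equivalent (with $\tau=\tau^f=f\tau^g$) to solutions $(\tau,\mu_b,\rho_{bc})$ of the system $$\nabla_a\tau-2\mu_a=0,\qquad \nabla_a\mu_b+B_\circ g_{ab}\tau-\rho_{ab}=0,\qquad \nabla_a\rho_{bc}+2B_\circ g_{a(b}\mu_{c)}=0,$$ where $\tau\in\Gamma(\mathcal E(2))$, $\mu_b\in\Gamma(T^*M(2))$, $\rho_{bc}\in\Gamma(S^2T^*M(2))$. On any open set where $\nabla_a\tau$ is nowhere zero, it lies in the Weyl nullity and $B^g=B_\circ$. (2) In particular, if $(M,g)$ has Weyl nullity and $B^g$ is constant, then solutions of the Gallot–Obata–Tanno equation $(\ast)$ with $B_\circ=B^g$ are in one-to-one correspondence with sections of $S^2\mathcal T^*$ that are parallel for the connection $\nabla^{\mathcal T_1}$.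
   Context: Manifolds are smooth and connected; metrics have arbitrary signature; indices are abstract, raised and lowered with $g$; round brackets denote symmetrisation. Conventions: $[\nabla_\ell,\nabla_k]v^j=R^j{}_{i\ell k}v^i$, $R_{jk}=R^a{}_{jak}$, $\mathsf P_{jk}=\frac1{n-1}R_{jk}$, and the projective Weyl tensor is $W^i{}_{jk\ell}=R^i{}_{jk\ell}+\delta^i_\ell\mathsf P_{jk}-\delta^i_k\mathsf P_{j\ell}$. A vector $v\in T_xM$ is in the Weyl nullity if $W^i{}_{jk\ell}v^j=0$ at $x$ (a 1-form lies in the nullity if the vector obtained by raising its index does; weights are irrelevant). $(M,g)$ has Weyl nullity if there is a nonzero such vector at every point. Where nonzero nullity vectors exist, $B^g$ is the number with $\mathsf P^i{}_jv^j=B^gv^i$ for all $v$ in the nullity (independent of $v$). $\mathcal E(1)$ is the positive $(2n+2)$-nd root of $(\Lambda^nTM)^2$, $\mathcal E(w)$ its real powers, $\mathcal B(w)=\mathcal B\otimes\mathcal E(w)$. The metric $g$ determines (as a root of its volume density) a canonical nowhere zero $\nabla$-parallel section $\tau^g$ of $\mathcal E(2)$. The cotractor bundle is $\mathcal T^*=J^1\mathcal E(1)$. The connection $\nabla$ splits it as $\mathcal E(1)\oplus T^*M(1)$ (via $j^1\sigma\mapsto(\sigma,\nabla_b\sigma)$), and hence $S^2\mathcal T^*\cong\mathcal E(2)\oplus T^*M(2)\oplus S^2T^*M(2)$, with the square of $(\sigma,\mu_b)$ having components $(\sigma^2,\sigma\mu_b,\mu_b\mu_c)$. In the presence of Weyl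 nullity with $B=B^g$ smooth, $\nabla^{\mathcal T_1}$ is the connection on $S^2\mathcal T^*$ given in this splitting by $$\nabla_a^{\mathcal T_1}(\tau,\mu_b,\rho_{bc})=(\nabla_a\tau-2\mu_a,\ \nabla_a\mu_b+Bg_{ab}\tau-\rho_{ab},\ \nabla_a\rho_{bc}+2Bg_{a(b}\mu_{c)}).$$ *)

(* Defs.v *)
From HB Require Import structures.
From mathcomp Require Import all_boot all_order all_algebra.
From mathcomp Require Import all_classical all_reals all_analysis.
Set Implicit Arguments.
Unset Strict Implicit.
Unset Printing Implicit Defensive.
Import Order.TTheory GRing.Theory Num.Theory.
Import numFieldNormedType.Exports.
Local Open Scope classical_set_scope.
Local Open Scope ring_scope.

(* C^k on an open set: all iterated partial derivatives of order <= k exist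
   and are continuous there. *)
Fixpoint Ck (R : realType) (n k : nat) (O : set 'rV[R]_n) (F : 'rV[R]_n -> R)
    : Prop :=
  (forall y, O y -> {for y, continuous F}) /\
  (if k is k'.+1 then
     forall a : 'I_n, (forall y, O y -> derivable F y (delta_mx 0 a)) /\
                      Ck k' O (fun y => derive F y (delta_mx 0 a))
   else True).

Definition smooth (R : realType) (n : nat) (O : set 'rV[R]_n)
  (F : 'rV[R]_n -> R) : Prop := forall k, Ck k O F.

(* The charts are total functions of which only the restrictions to
   [dom i] (for [coord i]) and to [coord i @` dom i] (for its inverse
   [icoord i]) are meaningful. *)
Record smooth_atlas (R : realType) (n : nat) (M : topologicalType) := Atlas {
  idx : Type;
  dom : idx -> set M;
  coord : idx -> M -> 'rV[R]_n;
  icoord : idx -> 'rV[R]_n -> M;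
  dom_cover : forall x, exists i, dom i x;
  dom_open : forall i, open (dom i);
  img_open : forall i, open (coord i @` dom i);
  coordK : forall i x, dom i x -> icoord i (coord i x) = x;
  coord_continuous : forall i x, dom i x -> {for x, continuous (coord i)};
  icoord_continuous :
    forall i x, dom i x -> {for coord i x, continuous (icoord i)};
  trans_smooth : forall i j (b : 'I_n),
    smooth (coord i @` (dom i `&` dom j))
           (fun y => coord j (icoord i y) 0 b)
}.
Arguments dom {R n M} s.
Arguments coord {R n M} s.
Arguments icoord {R n M} s.

Record smooth_manifold (R : realType) (n : nat) (M : topologicalType) :=
  Manifold {
    atlas :> smooth_atlas R n M;
    manifold_hausdorff : hausdorff_space M;
    manifold_second_countable : @second_countable M;
    manifold_connected : connected [set: M]
  }.

Section Geometry.
Variables (R : realType) (n : nat) (M : topologicalType).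
Variable A : smooth_atlas R n M.
Implicit Types (i j : idx A) (x : M) (a b c d k l : 'I_n).

(* Tensorial objects are families of components, one for each chart; the
   components in chart [i] are functions on M that are meaningful on
   [dom A i]. *)

(* partial derivative in chart i *)
Definition pd i a (u : M -> R) (x : M) : R :=
  derive (u \o icoord A i) (coord A i x) (delta_mx 0 a).

Definition smooth_on i (u : M -> R) : Prop :=
  smooth (coord A i @` dom A i) (u \o icoord A i).

Definition smooth_fun (f : M -> R) : Prop := forall i, smooth_on i f.

(* jac i j x a b = dy^b/dx^a for x^a, y^b the coordinates of charts i, j *)
Definition jac i j (x : M) : 'M[R]_n :=
  \matrix_(a, b) pd i a (fun y => coord A j y 0 b) x.

(* Transition factor of E(w): since E(1)^(2n+2) = (Lambda^n TM)^2, E(w) is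
   |Lambda^n TM|^(w/(n+1)); a section is given in chart i by its coefficient
   with respect to |d_1 /\ ... /\ d_n|^(w/(n+1)). *)
Definition dens (w : R) i j (x : M) : R :=
  `|\det (jac i j x)| `^ (- (w / n.+1%:R)).

(* Sections of E(w), T*M(w), S^2T*M(w). The meaningless values outside of the
   chart domains are normalised to 0, so that equality of sections is
   Leibniz equality. *)
Definition Esec (w : R) (s : idx A -> M -> R) : Prop :=
  [/\ forall i, smooth_on i (s i),
      forall i j x, dom A i x -> dom A j x -> s i x = dens w i j x * s j x
    & forall i x, ~ dom A i x -> s i x = 0].

Definition T1sec (w : R) (m : idx A -> M -> 'rV[R]_n) : Prop :=
  [/\ forall i a, smooth_on i (fun x => m i x 0 a),
      forall i j x, dom A i x -> dom A j x ->
        m i x = dens w i j x *: (m j x *m (jac i j x)^T)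
    & forall i x, ~ dom A i x -> m i x = 0].

Definition S2sec (w : R) (r : idx A -> M -> 'M[R]_n) : Prop :=
  [/\ forall i a b, smooth_on i (fun x => r i x a b),
      forall i x, (r i x)^T = r i x,
      forall i j x, dom A i x -> dom A j x ->
        r i x = dens w i j x *: (jac i j x *m r j x *m (jac i j x)^T)
    & forall i x, ~ dom A i x -> r i x = 0].

(* pseudo-Riemannian metrics, of arbitrary signature *)
Definition metric (g : idx A -> M -> 'M[R]_n) : Prop :=
  [/\ forall i a b, smooth_on i (fun x => g i x a b),
      forall i x, dom A i x -> (g i x)^T = g i x,
      forall i j x, dom A i x -> dom A j x ->
        g i x = jac i j x *m g j x *m (jac i j x)^T
    & forall i x, dom A i x -> g i x \in unitmx].

(* Connections on TM, through their Christoffel symbols: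
   nabla_a d_b = sum_c (G i c a b) d_c in chart i. *)
Definition affine_connection (G : idx A -> 'I_n -> 'I_n -> 'I_n -> M -> R)
    : Prop :=
  (forall i c a b, smooth_on i (G i c a b)) /\
  forall i j x, dom A i x -> dom A j x -> forall c a b,
    G i c a b x =
      \sum_k jac j i x k c *
        (\sum_p \sum_q jac i j x a p * jac i j x b q * G j k p q x
         + pd i a (fun y => jac i j y b k) x).

Definition torsion_free (G : idx A -> 'I_n -> 'I_n -> 'I_n -> M -> R) : Prop :=
  forall i x, dom A i x -> forall c a b, G i c a b x = G i c b a x.

Section Connection.
Variable G : idx A -> 'I_n -> 'I_n -> 'I_n -> M -> R.

(* nabla_a = d_a + w * conn1 on E(w): the connection form of Lambda^n TM is
   sum_c G^c_ac, and E(w) is its power w/(n+1). *)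
Definition conn1 i a (x : M) : R := (\sum_c G i c a c x) / n.+1%:R.

(* nabla_a s, for s in E(w) *)
Definition nabla0 (w : R) (s : idx A -> M -> R) i (x : M) : 'rV[R]_n :=
  \row_a (pd i a (s i) x + w * conn1 i a x * s i x).

(* nabla_a m_b, for m in T*M(w) *)
Definition nabla1 (w : R) (m : idx A -> M -> 'rV[R]_n) i (x : M) : 'M[R]_n :=
  \matrix_(a, b) (pd i a (fun y => m i y 0 b) x
                  - \sum_c G i c a b x * m i x 0 c
                  + w * conn1 i a x * m i x 0 b).

(* nabla_a r_bc, for r a covariant 2-tensor of weight w *)
Definition nabla2 (w : R) (r : idx A -> M -> 'M[R]_n) i (x : M) (a b c : 'I_n)
    : R :=
  pd i a (fun y => r i y b c) x
  - \sum_d G i d a b x * r i x d c - \sum_d G i d a c x * r i x b d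
  + w * conn1 i a x * r i x b c.

(* riem i j' p k l is R^j'_{p k l}, with [nabla_k, nabla_l] v^j' =
   R^j'_{p k l} v^p *)
Definition riem i (e p k l : 'I_n) (x : M) : R :=
  pd i k (G i e l p) x - pd i l (G i e k p) x
  + \sum_m (G i e k m x * G i m l p x - G i e l m x * G i m k p x).

Definition ricci i (p k : 'I_n) (x : M) : R := \sum_a riem i a p a k x.

Definition schouten i (p k : 'I_n) (x : M) : R :=
  (n%:R - 1)^-1 * ricci i p k x.

(* weyl i e p k l is W^e_{p k l} *)
Definition weyl i (e p k l : 'I_n) (x : M) : R :=
  riem i e p k l x + (e == l)%:R * schouten i p k x
                   - (e == k)%:R * schouten i p l x.

(* components in chart i of the vectors of T_xM in the Weyl nullity; this and
   the next conditions are tensorial, hence independent of the chart *)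
Definition nullity i (x : M) : set 'rV[R]_n :=
  [set v | forall e k l, \sum_p weyl i e p k l x * v 0 p = 0].

Definition nullity_at (x : M) : Prop :=
  forall i, dom A i x -> exists2 v, nullity i x v & v != 0.

Definition has_weyl_nullity : Prop := forall x, nullity_at x.

End Connection.

Section MetricConnection.
Variables (g : idx A -> M -> 'M[R]_n).
Variable G : idx A -> 'I_n -> 'I_n -> 'I_n -> M -> R.

Definition levi_civita : Prop :=
  [/\ affine_connection G, torsion_free G
    & forall i x, dom A i x -> forall a b c, nabla2 G 0 g i x a b c = 0].

Definition raise i (x : M) (m : 'rV[R]_n) : 'rV[R]_n := m *m invmx (g i x).

(* tau^g, in E(2), is the power -2/(n+1) of the volume density |det g|^(1/2)
   of weight -(n+1) *)
Definition tau_g i (x : M) : R := `|\det (g i x)| `^ (- (n.+1%:R)^-1).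

Definition tau_of (f : M -> R) i (x : M) : R := f x * tau_g i x.

(* P^e_p v^p = beta v^e for all v in the nullity at x, which is nonzero *)
Definition is_Bg (x : M) (beta : R) : Prop :=
  nullity_at G x /\
  forall i, dom A i x -> forall v, nullity G i x v -> forall e,
    \sum_p (\sum_k invmx (g i x) e k * schouten G i k p x) * v 0 p
    = beta * v 0 e.

Definition Bg (x : M) : R := get [set beta | is_Bg x beta].

Definition got_solution (B0 : R) (f : M -> R) : Prop :=
  smooth_fun f /\
  forall i x, dom A i x -> forall a b c,
    let df := nabla0 G 0 (fun=> f) in
    nabla2 G 0 (nabla1 G 0 df) i x a b c
    + B0 * (2 * g i x b c * df i x 0 a + g i x a b * df i x 0 c
            + g i x c a * df i x 0 b) = 0.

Definition triple : Type :=
  ((idx A -> M -> R) * (idx A -> M -> 'rV[R]_n) * (idx A -> M -> 'M[R]_n))%type.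

Definition system_solution (B0 : R) (s : triple) : Prop :=
  let: (tau, mu, rho) := s in
  [/\ Esec 2 tau, T1sec 2 mu, S2sec 2 rho &
    forall i x, dom A i x ->
    [/\ forall a, nabla0 G 2 tau i x 0 a - 2 * mu i x 0 a = 0,
        forall a b,
          nabla1 G 2 mu i x a b + B0 * g i x a b * tau i x - rho i x a b = 0
      & forall a b c,
          nabla2 G 2 rho i x a b c
          + B0 * (g i x a b * mu i x 0 c + g i x a c * mu i x 0 b) = 0]].

End MetricConnection.

(* The transition matrix of T* = J^1 E(1) from chart j to chart i, acting on
   the columns (sigma, d_a sigma): in chart i the coefficient of a section
   sigma of E(1) is (dens 1 i j) times its coefficient in chart j. *)
Definition jet_trans i j (x : M) : 'M[R]_(1 + n) :=
  block_mx (dens 1 i j x)%:M 0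
           (\col_a pd i a (dens 1 i j) x) (dens 1 i j x *: jac i j x).

(* sections of S^2 T*, as symmetric matrices *)
Definition S2Tsec (H : idx A -> M -> 'M[R]_(1 + n)) : Prop :=
  [/\ forall i (a b : 'I_(1 + n)), smooth_on i (fun x => H i x a b),
      forall i x, (H i x)^T = H i x,
      forall i j x, dom A i x -> dom A j x ->
        H i x = jet_trans i j x *m H j x *m (jet_trans i j x)^T
    & forall i x, ~ dom A i x -> H i x = 0].

Section Cotractors.
Variables (g : idx A -> M -> 'M[R]_n).
Variable G : idx A -> 'I_n -> 'I_n -> 'I_n -> M -> R.

(* (sigma, d_b sigma) |-> (sigma, nabla_b sigma), for sigma in E(1) *)
Definition split_mx i (x : M) : 'M[R]_(1 + n) :=
  block_mx 1%:M 0 (\col_b conn1 G i b x) 1%:M.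

(* The splitting of S^2 T*; the square of the column (sigma, mu) is the
   matrix with blocks sigma^2, sigma mu, mu mu. *)
Definition cotractor_split (H : idx A -> M -> 'M[R]_(1 + n)) : triple :=
  let K i x : 'M[R]_(1 + n) := split_mx i x *m H i x *m (split_mx i x)^T in
  (fun i x => ulsubmx (K i x) 0 0, fun i x => ursubmx (K i x),
   fun i x => drsubmx (K i x)).

(* nabla^{T_1}, in the splitting *)
Definition nabla_T1 (H : idx A -> M -> 'M[R]_(1 + n)) i (x : M) (a : 'I_n)
    : R * 'rV[R]_n * 'M[R]_n :=
  let: (tau, mu, rho) := cotractor_split H in
  let B := Bg g G x in
  (nabla0 G 2 tau i x 0 a - 2 * mu i x 0 a,
   \row_b (nabla1 G 2 mu i x a b + B * g i x a b * tau i x - rho i x a b),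
   \matrix_(b, c) (nabla2 G 2 rho i x a b c
     + B * (g i x a b * mu i x 0 c + g i x a c * mu i x 0 b))).

Definition T1_parallel (H : idx A -> M -> 'M[R]_(1 + n)) : Prop :=
  S2Tsec H /\
  forall i x, dom A i x -> forall a, nabla_T1 H i x a = (0, 0, 0).

End Cotractors.

(* tau is the section f tau^g *)
Definition corresponds (g : idx A -> M -> 'M[R]_n) (f : M -> R)
    (tau : idx A -> M -> R) : Prop :=
  forall i x, dom A i x -> tau i x = tau_of g f i x.

End Geometry.

(* r restricts to the graph of a bijection from P to Q *)
Definition one_to_one (X Y : Type) (P : X -> Prop) (Q : Y -> Prop)
    (r : X -> Y -> Prop) : Prop :=
  (forall x, P x -> exists ! y, Q y /\ r x y) /\
  (forall y, Q y -> exists ! x, P x /\ r x y).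

(* Main.v *)
Require Import Defs.
From HB Require Import structures.
From mathcomp Require Import all_boot all_order all_algebra.
From mathcomp Require Import all_classical all_reals all_analysis.
From mathcomp Require Import ring lra.
Import Order.TTheory GRing.Theory Num.Theory.
Import numFieldNormedType.Exports.
Set Implicit Arguments.
Unset Strict Implicit.
Unset Printing Implicit Defensive.
Local Open Scope classical_set_scope.
Local Open Scope ring_scope.

(* Since tau^g is parallel, the system says exactly that
     mu = tau^g df / 2   and   rho = tau^g (nabla df / 2 + B0 f g),
   and its last equation is then tau^g / 2 times the Gallot-Obata-Tanno
   equation. Skew-symmetrising the latter in its first two indices, the Ricci
   identity gives R_ab^d_c f_d = B0 (g_bc f_a - g_ac f_b): on the gradient v of f
   the curvature acts as that of a space of constant curvature B0, so that v is
   in the Weyl nullity with P v = B0 v. If w is another nullity vector, pairing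
   R(.,.)w with v and with w shows that P w - B0 w is proportional to v, and
   that it vanishes unless w is itself proportional to v.
   As tau^g is parallel in every chart, the transition factor of E(1) satisfies
   d (log dens) = J conn_j - conn_i, which is the statement that the splitting
   turns the transition matrices of J^1 E(1) into block diagonal ones. *)

(** * Calculus in several variables *)

Section MultivariableCalculus.
Context {R : realType}.

(** Smoothness is defined by iterated partial derivatives, so total differentiability of C^1
    functions and the symmetry of second derivatives have to be derived; the former underlies the
    chain rule for transition maps, the latter the Ricci identity and the skewness of the curvature.
    Components are meaningful only on chart domains, hence computations are made with germs at a
    point. For a fixed direction [a] the Christoffel symbols form a matrix, and most tensor
    identities become noncommutative matrix identities. That [tau_g] is parallel is Jacobi's formula
    for the determinant combined with the metric being parallel. The bound on [n] enters through the
    factor 1/(n-1) in [schouten]: tracing the curvature on the gradient produces (n-1) [B0]. *)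

Lemma is_derive_line n (F : 'rV[R]_n -> R) (y v : 'rV[R]_n) (d : R) :
  is_derive y v F d <-> is_derive (0 : R) 1 (fun h : R => F (h *: v + y)) d.
Proof.
have E : 'D_1 (fun h : R => F (h *: v + y)) (0 : R) = 'D_v F y.
  rewrite /derive.
  rewrite [X in lim (X @ _) = _](_ : _ = fun h => h^-1 *: (F (h *: v + y) - F y))//.
  by apply/funext => h /=; rewrite scale0r add0r addr0 [_%:A]mulr1.
split=> H; have H1 := @ex_derive _ _ _ _ _ _ _ H;
  have H2 := @derive_val _ _ _ _ _ _ _ H.
- apply: DeriveDef; first exact: (derivable1P F y v).1.
  by rewrite E.
- apply: DeriveDef; first exact: (derivable1P F y v).2.
  by rewrite -E.
Qed.

Lemma derive_comp1 n (F : 'rV[R]_n -> R) (phi : R -> R) (y v : 'rV[R]_n)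
    (d : R) :
  derivable F y v -> is_derive (F y) 1 phi d ->
  is_derive y v (phi \o F) (d * 'D_v F y).
Proof.
move=> dF dphi; apply/is_derive_line.
apply: (is_derive1_comp (g := fun h : R => F (h *: v + y))).
  by rewrite scale0r add0r.
by apply/is_derive_line; exact: derivableP.
Qed.

(** Writing the derivative as a multiple of |u|^p / u gives one formula for both signs of [u], and
    one in which the function itself recurs; the latter drives the induction in [Ck_abs_powR]. *)
Lemma is_derive_absV_powR (p u : R) : u != 0 ->
  is_derive u 1 (fun t : R => `|t| `^ p) (p * (`|u| `^ p * u^-1)).
Proof.
have pos (v : R) : 0 < v -> p * v `^ (p - 1) = p * (v `^ p * v^-1).
  move=> v0; rewrite powRB; last by rewrite (gt_eqF v0) implybT.
  by rewrite (powRr1 (ltW v0)).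
case: (ltgtP u 0) => // u0 _.
- have nu0 : 0 < - u by rewrite oppr_gt0.
  apply: (near_eq_is_derive (f := (fun t => powR t p) \o -%R)).
    near=> t; rewrite /= ltr0_norm//; near: t; exact: lt_nbhsl.
  have H1 := is_derive1_powR p nu0.
  have H3 : is_derive u 1 (-%R : R -> R) (-1) := is_deriveNid u 1.
  have H := is_derive1_comp H1 H3.
  apply: (is_derive_eq H).
  by rewrite ltr0_norm// pos// invrN; ring.
- apply: (near_eq_is_derive (f := (fun t => powR t p))).
    near=> t; rewrite /= gtr0_norm//; near: t; exact: lt_nbhsr.
  apply: (is_derive_eq (is_derive1_powR p u0)).
  by rewrite gtr0_norm// pos.
Unshelve. all: by end_near. Qed.

(** The increment [t] may have either sign, which spares case distinctions on the signs of
    coordinates in the uses below. *)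
Lemma MVT_dir n (F : 'rV[R]_n -> R) (z v : 'rV[R]_n) (t : R) :
  (forall s : R, `|s| <= `|t| -> derivable F (s *: v + z) v) ->
  exists2 s : R, `|s| <= `|t| &
    F (t *: v + z) - F z = t * 'D_v F (s *: v + z).
Proof.
move=> dF; pose f (s : R) := F (s *: v + z).
have fD (s : R) : `|s| <= `|t| -> is_derive s 1 f ('D_v F (s *: v + z)).
  move=> /dF /derivableP /is_derive_line d.
  (* The line is reparametrised so as to pass through the point of differentiation at time 0, as
     [is_derive_line] requires. *)
  have -> : f = (fun r : R => F (r *: v + (s *: v + z))) \o shift (- s).
    by apply/funext => h /=; rewrite addrA -scalerDl subrK.
  rewrite -[X in is_derive _ _ _ X]mulr1; apply: is_derive1_comp.
    by rewrite /= subrr.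
  exact: is_derive_shift.
have fc (a b : R) : `|a| <= `|t| -> `|b| <= `|t| ->
    {within `[a, b], continuous f}.
  move=> ha hb; apply: derivable_within_continuous => r.
  rewrite in_itv /= => /andP[ar rb]; apply: (@ex_derive _ _ _ _ _ _ _ (fD r _)).
  by rewrite ler_norml; move: ha hb; rewrite !ler_norml => /andP[? ?] /andP[? ?];
    apply/andP; split; lra.
have f0 : f 0 = F z by rewrite /f scale0r add0r.
have [t0|t0] := leP 0 t.
- have [||s] := @MVT_segment _ f (fun s => 'D_v F (s *: v + z)) 0 t t0.
  + move=> s; rewrite in_itv /= => /andP[s0 st]; apply: fD.
    by rewrite !ger0_norm// ltW.
  + by apply: fc; rewrite ?normr0.
  + rewrite in_itv /= => /andP[s0 st]; rewrite subr0 f0 mulrC => e.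
    by exists s => //; rewrite !ger0_norm.
- have [||s] := @MVT_segment _ f (fun s => 'D_v F (s *: v + z)) t 0 (ltW t0).
  + move=> s; rewrite in_itv /= => /andP[s0 st]; apply: fD.
    by rewrite !ltr0_norm// lerN2 ltW.
  + by apply: fc; rewrite ?normr0.
  + rewrite in_itv /= => /andP[s0 st]; rewrite f0 sub0r => e.
    exists s; first by rewrite ler0_norm// ltr0_norm// lerN2.
    by rewrite -[LHS]opprB e; ring.
Qed.

(** * Functions of class C^k on open sets, and symmetry of second derivatives *)

Section Euclidean.
Variable n : nat.
Local Notation V := 'rV[R]_n.
Implicit Types (F : V -> R) (O : set V) (y : V).

Lemma Ck_sub k O O' F : O' `<=` O -> Ck k O F -> Ck k O' F.
Proof.
move=> O'O; elim: k F => [|k IH] F /= [cF].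
  by move=> _; split=> // y /O'O /cF.
move=> dF; split=> [y /O'O /cF//|a]; have [d1 d2] := dF a.
by split=> [y /O'O /d1//|]; exact: IH.
Qed.

(** All conditions in [Ck] are imposed point by point in the ambient space, so they can be checked
    on the members of any cover of [O]. *)
Lemma Ck_local k O F :
  (forall y, O y -> exists2 O', O' y & Ck k O' F) -> Ck k O F.
Proof.
elim: k F => [|k IH] F H /=.
  by split=> // y /H[U Uy [c _]]; exact: c.
split=> [y /H[U Uy [c _]]|a]; first exact: c.
split=> [y /H[U Uy [_ /(_ a)[d _]]]|]; first exact: d.
by apply: IH => y /H[U Uy [_ /(_ a)[_ d]]]; exists U.
Qed.

Lemma CkS k O F : Ck k.+1 O F -> Ck k O F.
Proof.
elim: k F => [|k IH] F [cF dF]; first by split.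
by split=> // a; have [d1 d2] := dF a; split=> //; exact: IH.
Qed.

Lemma open_near_eq O F G y : open O -> O y -> {in O, F =1 G} ->
  \forall z \near y, F z = G z.
Proof.
move=> oO Oy FG; apply: filterS (open_nbhs_nbhs (conj oO Oy)) => z Oz.
by apply: FG; rewrite inE.
Qed.

Lemma near_eq_continuous F G y : (\forall z \near y, F z = G z) ->
  {for y, continuous F} -> {for y, continuous G}.
Proof.
move=> FG cF; have e := nbhs_singleton FG.
have cF' : F @ y --> G y by rewrite -e; exact: cF.
exact: (cvg_trans (near_eq_cvg FG) cF').
Qed.

Lemma Ck_eq k O F G : open O -> {in O, F =1 G} -> Ck k O F -> Ck k O G.
Proof.
move=> oO; elim: k F G => [|k IH] F G FG /= [cF dF].
  by split=> // y Oy; apply: near_eq_continuous (cF y Oy); exact: open_near_eq FG.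
split=> [y Oy|a].
  by apply: near_eq_continuous (cF y Oy); exact: open_near_eq FG.
have [d1 d2] := dF a; split=> [y Oy|].
  by apply: near_eq_derivable (d1 y Oy); exact: open_near_eq FG.
apply: IH d2 => y; rewrite inE => Oy.
by apply: near_eq_derive; exact: open_near_eq FG.
Qed.

Lemma Ck_cst k O (c : R) : Ck k O (cst c).
Proof.
elim: k c => [|k IH] c; (split=> [y _|]; first exact: cst_continuous) => // a.
split=> [y _|]; first exact: derivable_cst.
rewrite (_ : (fun y => _) = cst 0) ?funeqE// => y; exact: derive_cst.
Qed.

Lemma CkD k O F G : open O -> Ck k O F -> Ck k O G -> Ck k O (F \+ G).
Proof.
move=> oO; elim: k F G => [|k IH] F G [cF dF] [cG dG].
  by split=> // y Oy; exact: (continuousD (cF y Oy) (cG y Oy)).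
split=> [y Oy|a]; first by exact: (continuousD (cF y Oy) (cG y Oy)).
have [dF1 dF2] := dF a; have [dG1 dG2] := dG a.
split=> [y Oy|]; first by apply: derivableD; [exact: dF1|exact: dG1].
apply: Ck_eq (IH _ _ dF2 dG2) => // y; rewrite inE => Oy /=.
by rewrite -(deriveD (dF1 y Oy) (dG1 y Oy)).
Qed.

Lemma CkM k O F G : open O -> Ck k O F -> Ck k O G -> Ck k O (F \* G).
Proof.
move=> oO; elim: k F G => [|k IH] F G CF CG.
  case: CF CG => [cF _] [cG _].
  by split=> // y Oy; exact: (continuousM (cF y Oy) (cG y Oy)).
have [cF dF] := CF; have [cG dG] := CG.
split=> [y Oy|a]; first by exact: (continuousM (cF y Oy) (cG y Oy)).
have [dF1 dF2] := dF a; have [dG1 dG2] := dG a.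
split=> [y Oy|]; first by apply: derivableM; [exact: dF1|exact: dG1].
apply: Ck_eq (CkD oO (IH _ _ (CkS CF) dG2) (IH _ _ (CkS CG) dF2)) => // y.
by rewrite inE => Oy /=; rewrite (deriveM (dF1 y Oy) (dG1 y Oy)).
Qed.

(** The derivative of 1/F is -(1/F)^2 F', where 1/F is needed only to the order that the induction
    on [k] already provides. *)
Lemma Ck_inv k O F : open O -> (forall y, O y -> F y != 0) -> Ck k O F ->
  Ck k O (fun y => (F y)^-1).
Proof.
move=> oO F0; elim: k => [|k IH] CF; have [cF dF] := CF.
  by split=> // y Oy; exact: (continuousV (F0 y Oy) (cF y Oy)).
split=> [y Oy|a]; first by exact: (continuousV (F0 y Oy) (cF y Oy)).
have [dF1 dF2] := dF a; have CI := IH (CkS CF).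
split=> [y Oy|]; first by apply: derivableV; [exact: F0|exact: dF1].
apply: Ck_eq (CkM oO (CkM oO (Ck_cst k O (-1)) (CkM oO CI CI)) dF2) => // y.
rewrite inE => Oy /=; rewrite (deriveV (F0 _ Oy) (dF1 y Oy)) /=.
by rewrite /GRing.scale /= expr2 invfM mulN1r.
Qed.

Lemma Ck_abs_powR k O F (p : R) : open O -> (forall y, O y -> F y != 0) ->
  Ck k O F -> Ck k O (fun y => `|F y| `^ p).
Proof.
move=> oO F0; elim: k => [|k IH] CF; have [cF dF] := CF.
  split=> // y Oy; apply: (continuous_comp (f := F) (g := fun t => `|t| `^ p)).
    exact: cF.
  apply: differentiable_continuous; apply/derivable1_diffP.
  by have [] := is_derive_absV_powR p (F0 y Oy).
have D y a : O y -> derivable F y (delta_mx 0 a) ->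
    is_derive y (delta_mx 0 a) (fun y => `|F y| `^ p)
      (p * (`|F y| `^ p * (F y)^-1) * 'D_(delta_mx 0 a) F y).
  move=> Oy d; apply: (derive_comp1 (phi := fun t => `|t| `^ p)) => //.
  exact: is_derive_absV_powR (F0 y Oy).
split=> [y Oy|a].
  apply: (continuous_comp (f := F) (g := fun t => `|t| `^ p)).
    exact: cF.
  apply: differentiable_continuous; apply/derivable1_diffP.
  by have [] := is_derive_absV_powR p (F0 y Oy).
have [dF1 dF2] := dF a.
split=> [y Oy|]; first by have [] := D y a Oy (dF1 _ Oy).
have CF' := CkS CF.
apply: Ck_eq (CkM oO (CkM oO (Ck_cst k O p)
  (CkM oO (IH CF') (Ck_inv oO F0 CF'))) dF2) => // y.
by rewrite inE => Oy /=; have [_ ->] := D y a Oy (dF1 _ Oy).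
Qed.

Lemma Ck_sum k O m (F : 'I_m -> V -> R) : open O ->
  (forall i, Ck k O (F i)) -> Ck k O (fun y => \sum_i F i y).
Proof.
move=> oO; elim: m F => [|m IH] F CF.
  apply: Ck_eq (Ck_cst k O 0) => // y _.
  by rewrite big_ord0.
apply: Ck_eq (CkD oO (IH (fun i => F (widen_ord (leqnSn m) i)) _) (CF ord_max)) => //.
by move=> y _ /=; rewrite big_ord_recr.
Qed.

Let norm_rVE (h : V) : `|h| = \big[Num.max/0]_ij `|h ij.1 ij.2|.
Proof. exact: mx_normrE. Qed.

Lemma norm_delta_mx (a : 'I_n) : `|delta_mx 0 a : V| <= 1.
Proof.
rewrite norm_rVE; apply/bigmax_leP; split=> // -[i b] _ /=.
by rewrite mxE; case: (_ && _); rewrite ?normr1 ?normr0 ?ler01.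
Qed.

Lemma ler_norm_entry (h : V) (a : 'I_n) : `|h 0 a| <= `|h|.
Proof.
by rewrite norm_rVE; apply: (le_bigmax _ _ (0, a)).
Qed.

Lemma ler_norm_mx (h : V) (e : R) : 0 <= e -> (forall a, `|h 0 a| <= e) ->
  `|h| <= e.
Proof.
move=> e0 he; rewrite norm_rVE; apply/bigmax_leP; split=> // -[i b] _ /=.
by rewrite ord1.
Qed.

(** The vertices of the path from 0 to [h] whose legs are parallel to the axes. *)
Let trunc (h : V) (k : nat) : V := \row_a (if (a < k)%N then h 0 a else 0).

(** The increment of [F] telescopes along the path [trunc h]; on each leg the mean value theorem
    gives a partial derivative at a nearby point, which continuity compares with the one at [y]. *)
Lemma C1_differentiable O F y : open O -> O y -> Ck 1 O F -> differentiable F y.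
Proof.
move=> oO Oy [cF dF].
pose L (h : V) : R := \sum_a h 0 a * 'D_(delta_mx 0 a) F y.
have Ll : linear L.
  move=> k u v; rewrite /L scaler_sumr -big_split; apply: eq_bigr => a _ /=.
  by rewrite !mxE mulrDl -mulrA.
pose L' : {linear V -> R} := HB.pack L (GRing.isLinear.Build _ _ _ _ L Ll).
have Lc : continuous L.
  have Lac (a : 'I_n) (c : R) : continuous (fun h : V => h 0 a * c).
    move=> h; apply: (@continuousM _ _ (fun h : V => h 0 a) (cst c)).
      exact: coord_continuous.
    exact: cst_continuous.
  apply: (continuous_big (op := +%R)); first exact: add_continuous.
  by move=> a _; exact: Lac.
have E : F \o shift y = cst (F y) + L +o_ (0 : V) id.
  apply/eqaddoP => e e0.
  (* There are [n] legs, each contributing at most this share of the error; [n.+1] keeps the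
     quotient meaningful for [n = 0]. *)
  have e0' : 0 < e / n.+1%:R by rewrite divr_gt0.
  have Hnear : \forall z \near y, O z /\ forall a : 'I_n,
      `|'D_(delta_mx 0 a) F y - 'D_(delta_mx 0 a) F z| <= e / n.+1%:R.
    apply: (filterI (open_nbhs_nbhs (conj oO Oy))).
    apply: (@filter_forall _ _ _ (nbhs y)) => a.
    have [_ [ca _]] := dF a.
    by have /cvgrPdist_le := ca y Oy; exact.
  have [r /= r0 Hr] := (nbhs_ballP _ _).1 Hnear.
  apply/nbhs_ballP; exists r => //= h.
  rewrite -ball_normE /ball_ /= sub0r normrN => hr.
  have trE (a : 'I_n) : trunc h a.+1 = h 0 a *: delta_mx 0 a + trunc h a.
    apply/rowP => b; rewrite !mxE eqxx /= ltnS leq_eqVlt -val_eqE.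
    by case: (ltngtP b a) => [||/ord_inj->] /=;
      rewrite ?mulr0 ?mulr1 ?add0r ?addr0.
  (* The norm is the sup norm, so no leg of the path leaves the ball of radius |h|. *)
  have near_pt (a : 'I_n) (s : R) : `|s| <= `|h 0 a| ->
      `|s *: (delta_mx 0 a : V) + trunc h a| <= `|h|.
    move=> hs; apply: ler_norm_mx => // b; rewrite !mxE eqxx /= -val_eqE.
    case: (ltngtP b a) => [||_] /=;
      rewrite ?mulr0 ?mulr1 ?add0r ?addr0 ?normr0 ?ler_norm_entry//.
    exact: le_trans hs (ler_norm_entry _ _).
  have tr0 : trunc h 0 = 0 by apply/rowP => b; rewrite !mxE.
  have trn : trunc h n = h by apply/rowP => b; rewrite !mxE ltn_ord.
  have -> : (F \o shift y - (cst (F y) + L)) h = \sum_(a < n)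
      (F (trunc h a.+1 + y) - F (trunc h a + y) - h 0 a * 'D_(delta_mx 0 a) F y).
    rewrite sumrB -(big_mkord xpredT
      (fun k => F (trunc h k.+1 + y) - F (trunc h k + y))).
    rewrite telescope_sumr// trn tr0 add0r.
    by rewrite -[LHS]/(F (h + y) - (F y + L h)) opprD addrA.
  apply: (le_trans (ler_norm_sum _ _ _)).
  apply: (@le_trans _ _ (\sum_(a < n) (e / n.+1%:R * `|h|))).
    apply: ler_sum => a _.
    have in_ball (s : R) : `|s| <= `|h 0 a| ->
        ball y r (s *: delta_mx 0 a + (trunc h a + y)).
      move=> hs; rewrite -ball_normE /ball_ /= -normrN opprB addrA addrK.
      exact: le_lt_trans (near_pt _ _ hs) hr.
    have [s hs] := MVT_dir (F := F) (z := trunc h a + y)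
      (v := delta_mx 0 a) (t := h 0 a)
      (fun s hs => (dF a).1 _ (Hr _ (in_ball s hs)).1).
    rewrite trE -[_ + trunc h a + y]addrA => ->; rewrite -mulrBr normrM mulrC.
    apply: ler_pM => //; last exact: ler_norm_entry.
    by rewrite distrC; apply: (Hr _ (in_ball s hs)).2.
  rewrite sumr_const card_ord -mulrnAl; apply: ler_wpM2r => //.
  rewrite -mulr_natr -mulrA ler_piMr//; first exact: ltW.
  by rewrite ler_pdivrMl ?ltr0n// mulr1 ler_nat.
have dE : 'd F y = L' :> (V -> R).
  exact: (@diff_unique _ _ _ F L' y Lc E).
apply/diff_locallyP; rewrite dE; split => //.
Qed.

Lemma derive_differentiable F y (v : V) : differentiable F y ->
  'D_v F y = \sum_a v 0 a * 'D_(delta_mx 0 a) F y.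
Proof.
move=> dF; rewrite deriveE// [in LHS](row_sum_delta v) linear_sum.
by apply: eq_bigr => a _; rewrite linearZ deriveE.
Qed.

Let close (e A B C D : R) : `|A - C| <= e / 2 -> C = D -> `|B - D| <= e / 2 ->
  `|B - A| <= e.
Proof.
move=> h <-; move: h; rewrite !ler_norml => /andP[? ?] /andP[? ?].
by apply/andP; split; lra.
Qed.

(** The second difference of [F] over a small square does not depend on the order of its two
    directions; two applications of the mean value theorem express it through either mixed
    derivative at a point near [y]. *)
Lemma pderiv_comm O F y (a b : 'I_n) : open O -> O y -> Ck 2 O F ->
  'D_(delta_mx 0 a) (fun z => 'D_(delta_mx 0 b) F z) y =
  'D_(delta_mx 0 b) (fun z => 'D_(delta_mx 0 a) F z) y.
Proof.
move=> oO Oy [cF dF].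
have [rO rO0 HrO] := (nbhs_ballP _ _).1 (open_nbhs_nbhs (conj oO Oy)).
have pt (c d : 'I_n) (s t r : R) : 0 < r -> `|s| <= r / 4 -> `|t| <= r / 4 ->
    ball y r (s *: delta_mx 0 c + (t *: delta_mx 0 d + y)).
  move=> r0 hs ht; rewrite -ball_normE /ball_ /= -normrN opprB addrA addrK.
  apply: (le_lt_trans (ler_normD _ _)); rewrite !normrZ.
  have h1 := ler_pM (normr_ge0 s) (normr_ge0 _) hs (norm_delta_mx c).
  have h2 := ler_pM (normr_ge0 t) (normr_ge0 _) ht (norm_delta_mx d).
  lra.
(* The mean value theorem is applied in direction [c] to the difference [Q] of [F] over a step in
   direction [d], then in direction [d] to the partial derivative along [c]. *)
have key (c d : 'I_n) (t r : R) : 0 < r -> r <= rO -> 0 < t -> t <= r / 4 ->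
    exists2 z, ball y r z &
    F (t *: delta_mx 0 c + (t *: delta_mx 0 d + y)) - F (t *: delta_mx 0 c + y)
      - (F (t *: delta_mx 0 d + y) - F y) =
    t * t * 'D_(delta_mx 0 d) (fun z => 'D_(delta_mx 0 c) F z) z.
  move=> r0 rrO t0 tr.
  have Oin s u (c' d' : 'I_n) : `|s| <= r / 4 -> `|u| <= r / 4 ->
      O (s *: delta_mx 0 c' + (u *: delta_mx 0 d' + y)).
    by move=> hs hu; apply/HrO/(le_ball rrO)/pt.
  have Oin1 s (c' : 'I_n) : `|s| <= r / 4 -> O (s *: delta_mx 0 c' + y).
    move=> hs; rewrite -[y]add0r -[X in _ + (X + _)](scale0r (delta_mx 0 c')).
    by apply: Oin => //; rewrite normr0; lra.
  have tn : `|t| <= r / 4 by rewrite gtr0_norm.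
  pose Q (z : V) := F (t *: delta_mx 0 d + z) - F z.
  have shiftD (w z : V) : O (w + z) -> is_derive z (delta_mx 0 c)
      (fun z => F (w + z)) ('D_(delta_mx 0 c) F (w + z)).
    move=> /((dF c).1) /derivableP /is_derive_line H; apply/is_derive_line.
    by under eq_fun do rewrite addrCA.
  have QD s : `|s| <= `|t| -> is_derive (s *: delta_mx 0 c + y) (delta_mx 0 c) Q
      ('D_(delta_mx 0 c) F (t *: delta_mx 0 d + (s *: delta_mx 0 c + y))
       - 'D_(delta_mx 0 c) F (s *: delta_mx 0 c + y)).
    move=> hs; have hs' := le_trans hs tn.
    apply: is_deriveB; first by apply: shiftD; exact: Oin.
    by apply/derivableP/(dF c).1/Oin1.
  have [s hs] := MVT_dir (F := Q) (z := y) (v := delta_mx 0 c) (t := t)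
    (fun s hs => @ex_derive _ _ _ _ _ _ _ (QD s hs)).
  rewrite (@derive_val _ _ _ _ _ _ _ (QD s hs)) => e1.
  have hs' := le_trans hs tn.
  have [u hu e2] := MVT_dir (F := fun z => 'D_(delta_mx 0 c) F z)
    (z := s *: delta_mx 0 c + y) (v := delta_mx 0 d) (t := t)
    (fun u hu => ((dF c).2.2 d).1 _ (Oin _ _ _ _ (le_trans hu tn) hs')).
  exists (u *: delta_mx 0 d + (s *: delta_mx 0 c + y)).
    exact: pt (le_trans hu tn) hs'.
  rewrite e2 /Q in e1; rewrite -mulrA -e1.
  by rewrite ![t *: delta_mx 0 d + (t *: delta_mx 0 c + y)]addrCA.
apply/eqP; rewrite -subr_eq0 -normr_le0; apply/ler_addgt0Pr => e e0.
rewrite add0r.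
have e20 : 0 < e / 2 by rewrite divr_gt0.
have cont (c d : 'I_n) : exists2 r : R, 0 < r & forall z, ball y r z ->
   `|'D_(delta_mx 0 d) (fun z => 'D_(delta_mx 0 c) F z) y -
     'D_(delta_mx 0 d) (fun z => 'D_(delta_mx 0 c) F z) z| <= e / 2.
  have [cc _] := ((dF c).2.2 d).2.
  have /cvgrPdist_le /(_ _ e20) /nbhs_ballP [r r0 Hr] := cc y Oy.
  by exists r.
have [r1 r10 Hr1] := cont a b; have [r2 r20 Hr2] := cont b a.
pose r := Num.min rO (Num.min r1 r2).
have r0 : 0 < r by rewrite !lt_min rO0 r10 r20.
have [rrO rr1 rr2] : [/\ r <= rO, r <= r1 & r <= r2].
  by rewrite /r !ge_min !lexx !orbT.
have t0 : 0 < r / 4 by rewrite divr_gt0.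
have [z1 hz1 e1] := key a b _ r r0 rrO t0 (lexx _).
have [z2 hz2 e2] := key b a _ r r0 rrO t0 (lexx _).
(* Both sides of the symmetric second difference are divided by the area of the square. *)
have {e1 e2} e12 : 'D_(delta_mx 0 b) (fun z => 'D_(delta_mx 0 a) F z) z1 =
    'D_(delta_mx 0 a) (fun z => 'D_(delta_mx 0 b) F z) z2.
  have tt0 : r / 4 * (r / 4) != 0 by rewrite gt_eqF// mulr_gt0.
  have cancel (k A B C D : R) : k != 0 -> C = k * A -> D = k * B -> C = D -> A = B.
    by move=> k0 -> ->; exact: mulfI.
  apply: (cancel _ _ _ _ _ tt0 e1 e2).
  by rewrite [X in F X - _ - _]addrCA; ring.
have h1 := Hr1 _ (le_ball rr1 hz1); have h2 := Hr2 _ (le_ball rr2 hz2).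
exact: (close h1 e12 h2).
Qed.

End Euclidean.

Lemma continuous_rV (T : topologicalType) m (Phi : T -> 'rV[R]_m) (y : T) :
  (forall b, {for y, continuous (fun z => Phi z 0 b)}) ->
  {for y, continuous Phi}.
Proof.
move=> c; apply/cvgrPdist_le => e e0.
have H : \forall z \near y, forall b, `|Phi y 0 b - Phi z 0 b| <= e.
  apply: (@filter_forall _ _ _ (nbhs y)) => b.
  by have /cvgrPdist_le := c b; exact.
apply: filterS H => z Hz; apply: ler_norm_mx => [|b]; first exact: ltW.
by rewrite !mxE.
Qed.

(** Restricting [Phi] to the line through [y] in direction [v] gives a curve, so total
    differentiability is asked of [F] alone, and of [Phi] only a directional derivative. *)
Lemma chain_rule n m (Phi : 'rV[R]_n -> 'rV[R]_m) (F : 'rV[R]_m -> R)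
    (y v : 'rV[R]_n) :
  (forall b, derivable (fun z => Phi z 0 b) y v) ->
  differentiable F (Phi y) ->
  is_derive y v (F \o Phi)
    (\sum_b 'D_v (fun z => Phi z 0 b) y * 'D_(delta_mx 0 b) F (Phi y)).
Proof.
move=> dPhi dF; apply/is_derive_line.
pose c (h : R) := Phi (h *: v + y).
have c0 : c 0 = Phi y by rewrite /c scale0r add0r.
have dcb b : is_derive (0 : R) 1 (fun h => c h 0 b) ('D_v (fun z => Phi z 0 b) y).
  by have /derivableP/is_derive_line := dPhi b.
have dc : derivable c 0 1.
  by apply/derivable_mxP => i b; rewrite ord1; have [] := dcb b.
have diffc : differentiable c 0 by apply/derivable1_diffP.
have diffF : differentiable F (c 0) by rewrite c0.
have diffFc : differentiable (F \o c) 0 by exact: differentiable_comp.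
apply: DeriveDef; first exact/derivable1_diffP.
rewrite -[LHS]/('D_1 (F \o c) 0) deriveE// diff_comp//= -deriveE// -deriveE//.
rewrite derive_differentiable// c0; apply: eq_bigr => b _.
by rewrite derive_mx// mxE (@derive_val _ _ _ _ _ _ _ (dcb b)).
Qed.

Lemma Ck_comp n m k (O : set 'rV[R]_n) (U : set 'rV[R]_m)
    (Phi : 'rV[R]_n -> 'rV[R]_m) (F : 'rV[R]_m -> R) :
  open O -> open U -> (forall y, O y -> U (Phi y)) ->
  (forall b, Ck k O (fun y => Phi y 0 b)) -> Ck k U F -> Ck k O (F \o Phi).
Proof.
move=> oO oU OU; elim: k F => [|k IH] F CPhi CF.
  have [cF _] := CF; split=> // y Oy; apply: continuous_comp; last exact/cF/OU.
  by apply: continuous_rV => b; have [+ _] := CPhi b; exact.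
have CPhi' b := CkS (CPhi b).
have D y a : O y -> is_derive y (delta_mx 0 a) (F \o Phi)
    (\sum_b 'D_(delta_mx 0 a) (fun z => Phi z 0 b) y *
            'D_(delta_mx 0 b) F (Phi y)).
  move=> Oy; apply: chain_rule => [b|].
    by have [_ /(_ a)[+ _]] := CPhi b; exact.
  apply: (C1_differentiable oU (OU _ Oy)).
  (* The class of [F] is lowered from C^(k+1) to C^1. *)
  by elim: (k) CF => [//|k' IHk] CF; apply: IHk; exact: CkS.
split=> [y Oy|a].
  apply: continuous_comp; last by have [cF _] := CF; exact/cF/OU.
  by apply: continuous_rV => b; have [+ _] := CPhi b; exact.
split=> [y Oy|]; first by have [] := D y a Oy.
have CS : Ck k O (fun y => \sum_b 'D_(delta_mx 0 a) (fun z => Phi z 0 b) y *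
            'D_(delta_mx 0 b) F (Phi y)).
  apply: Ck_sum => // b.
  apply: (CkM (F := fun y => 'D_(delta_mx 0 a) (fun z => Phi z 0 b) y)
    (G := (fun w => 'D_(delta_mx 0 b) F w) \o Phi) oO).
    by have [_ /(_ a)[_]] := CPhi b.
  by apply: IH => //; have [_ /(_ b)[_]] := CF.
apply: Ck_eq CS => // y; rewrite inE => Oy /=.
by have [_ ->] := D y a Oy.
Qed.

End MultivariableCalculus.

(* The name is shadowed by [vector.coord]. *)
Local Notation coord := Defs.coord.

(** * Calculus in charts *)

Section ManifoldCalculus.
Context {R : realType} {n : nat} {M : topologicalType}.
Variable A : smooth_atlas R n M.
Implicit Types (i j : idx A) (x : M) (a b c : 'I_n) (u v : M -> R).

(** Smoothness of the germ of [u] at [x]: the expressions compared below often agree only near a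
    point, for instance on the overlap of two charts. *)
Definition smooth_near i x u : Prop :=
  exists Q, [/\ open Q, Q (coord A i x), Q `<=` coord A i @` dom A i
    & smooth Q (u \o icoord A i)].

Lemma near_open (T : topologicalType) (t : T) (P : set T) :
  (\forall z \near t, P z) -> exists2 W, open_nbhs t W & W `<=` P.
Proof. by move=> nP; have : nbhs t P by []; rewrite nbhsE => -[W oW WP]; exists W. Qed.

Lemma near_dom i x : dom A i x -> \forall y \near x, dom A i y.
Proof. by move=> d; apply: open_nbhs_nbhs; split=> //; exact: dom_open. Qed.

Lemma near_icoord i x (P : M -> Prop) : dom A i x -> (\forall y \near x, P y) ->
  \forall z \near coord A i x, P (icoord A i z).
Proof.
by move=> d nP; apply: (icoord_continuous d); rewrite /= coordK.
Qed.

Lemma near_img i x : dom A i x ->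
  \forall z \near coord A i x, (coord A i @` dom A i) z.
Proof.
by move=> d; apply: open_nbhs_nbhs; split; [exact: img_open|exists x].
Qed.

Lemma smooth_sub (Q U : set 'rV[R]_n) F : U `<=` Q -> smooth Q F -> smooth U F.
Proof. by move=> UO sF k; exact: Ck_sub UO (sF k). Qed.

Lemma smooth_onP i u : smooth_on i u <-> forall x, dom A i x -> smooth_near i x u.
Proof.
split=> [su x d|su k].
  by exists (coord A i @` dom A i); split; [exact: img_open|exists x|by []|exact: su].
by apply: Ck_local => _ [x d <-]; have [Q [_ Ox _ /(_ k)]] := su x d; exists Q.
Qed.

Lemma smooth_near_eq i x u v : dom A i x -> (\forall y \near x, u y = v y) ->
  smooth_near i x u -> smooth_near i x v.
Proof.
move=> d uv [Q [oO Ox Oi su]].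
have [W [oW Wx] HW] : exists2 W, open_nbhs (coord A i x) W &
    W `<=` [set z | u (icoord A i z) = v (icoord A i z)].
  exact: near_open (near_icoord d uv).
exists (Q `&` W); split=> [|//|z [/Oi]//|]; first exact: openI.
move=> k; apply: Ck_eq (Ck_sub _ (su k)); first exact: openI.
  by move=> z; rewrite inE => -[_ /HW].
by move=> z [].
Qed.

Lemma smooth_near_near i x u : dom A i x -> smooth_near i x u ->
  \forall y \near x, smooth_near i y u.
Proof.
move=> d [Q [oO Ox Oi su]].
have nO : nbhs (coord A i x) Q by exact: open_nbhs_nbhs.
have nx : nbhs x (coord A i @^-1` Q) by exact: (Defs.coord_continuous d) nO.
by apply: filterS nx => y Oy; exists Q.
Qed.

Lemma smooth_near2 i x u v : smooth_near i x u -> smooth_near i x v ->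
  exists Q, [/\ open Q, Q (coord A i x), Q `<=` coord A i @` dom A i,
    smooth Q (u \o icoord A i) & smooth Q (v \o icoord A i)].
Proof.
move=> [Q [oO Ox Oi su]] [W [oW Wx Wi sv]]; exists (Q `&` W).
split=> [|//|z [/Oi]//||]; first exact: openI.
  by apply: smooth_sub su => z [].
by apply: smooth_sub sv => z [].
Qed.

Lemma smooth_near_cst i x (r : R) : dom A i x -> smooth_near i x (fun=> r).
Proof.
move=> d; exists (coord A i @` dom A i).
by split; [exact: img_open|exists x|by []|move=> k; exact: Ck_cst].
Qed.

Lemma smooth_nearD i x u v : smooth_near i x u -> smooth_near i x v ->
  smooth_near i x (fun y => u y + v y).
Proof.
move=> su sv; have [Q [oO Ox Oi su' sv']] := smooth_near2 su sv.
by exists Q; split=> // k; exact: CkD.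
Qed.

Lemma smooth_nearM i x u v : smooth_near i x u -> smooth_near i x v ->
  smooth_near i x (fun y => u y * v y).
Proof.
move=> su sv; have [Q [oO Ox Oi su' sv']] := smooth_near2 su sv.
by exists Q; split=> // k; exact: CkM.
Qed.

Lemma smooth_nearZ i x (r : R) u : dom A i x -> smooth_near i x u ->
  smooth_near i x (fun y => r * u y).
Proof. by move=> d; apply: smooth_nearM; exact: smooth_near_cst. Qed.

Lemma smooth_nearN i x u : dom A i x -> smooth_near i x u ->
  smooth_near i x (fun y => - u y).
Proof.
by move=> d /(smooth_nearZ (-1) d); under eq_fun do rewrite mulN1r.
Qed.

Lemma smooth_nearB i x u v : dom A i x -> smooth_near i x u ->
  smooth_near i x v -> smooth_near i x (fun y => u y - v y).
Proof. by move=> d su /(smooth_nearN d); exact: smooth_nearD. Qed.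

Lemma smooth_near_sum i x (I : Type) (r : seq I) (P : pred I) (F : I -> M -> R) :
  dom A i x -> (forall k, P k -> smooth_near i x (F k)) ->
  smooth_near i x (fun y => \sum_(k <- r | P k) F k y).
Proof.
move=> d sF; elim: r => [|k r IH].
  by under eq_fun do rewrite big_nil; exact: smooth_near_cst.
under eq_fun do rewrite big_cons.
by case: (boolP (P k)) => [Pk|_] //=; exact: (smooth_nearD (sF k Pk) IH).
Qed.

Lemma smooth_near_prod i x (I : Type) (r : seq I) (F : I -> M -> R) :
  dom A i x -> (forall k, smooth_near i x (F k)) ->
  smooth_near i x (fun y => \prod_(k <- r) F k y).
Proof.
move=> d sF; elim: r => [|k r IH].
  by under eq_fun do rewrite big_nil; exact: smooth_near_cst.
by under eq_fun do rewrite big_cons; exact: (smooth_nearM (sF k) IH).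
Qed.

Lemma smooth_near_nz i x u : u x != 0 -> dom A i x -> smooth_near i x u ->
  exists Q, [/\ open Q, Q (coord A i x), Q `<=` coord A i @` dom A i,
    smooth Q (u \o icoord A i) & forall z, Q z -> u (icoord A i z) != 0].
Proof.
move=> u0 d [Q [oO Ox Oi su]].
have [W [oW Wx] HW] : exists2 W, open_nbhs (coord A i x) W &
    W `<=` [set z | u (icoord A i z) != 0].
  apply: near_open; have [c _] := su 0%N.
  have nz : \forall r \near (u \o icoord A i) (coord A i x), r != 0.
    by apply: open_nbhs_nbhs; split; [exact: open_neq|rewrite /= coordK].
  exact: (c _ Ox) nz.
exists (Q `&` W); split=> [|//|z [/Oi]//||z [_ /HW]//]; first exact: openI.
by apply: smooth_sub su => z [].
Qed.

Lemma smooth_nearV i x u : u x != 0 -> dom A i x -> smooth_near i x u ->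
  smooth_near i x (fun y => (u y)^-1).
Proof.
move=> u0 d /(smooth_near_nz u0 d)[Q [oO Ox Oi su O0]].
by exists Q; split=> // k; exact: (Ck_inv oO O0 (su k)).
Qed.

Lemma smooth_near_powR i x u (p : R) : u x != 0 -> dom A i x ->
  smooth_near i x u -> smooth_near i x (fun y => `|u y| `^ p).
Proof.
move=> u0 d /(smooth_near_nz u0 d)[Q [oO Ox Oi su O0]].
by exists Q; split=> // k; exact: (Ck_abs_powR p oO O0 (su k)).
Qed.

Lemma coordK_img i (z : 'rV[R]_n) : (coord A i @` dom A i) z ->
  coord A i (icoord A i z) = z.
Proof. by case=> x d <-; rewrite coordK. Qed.

Lemma smooth_near_pd i x a u : smooth_near i x u -> smooth_near i x (pd i a u).
Proof.
move=> [Q [oO Ox Oi su]]; exists Q; split=> // k.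
have [_ /(_ a)[_ C]] := su k.+1; apply: Ck_eq C => // z.
by rewrite inE => Oz; rewrite /pd /= coordK_img//; exact: Oi.
Qed.

Lemma smooth_near_derivable i x a u : smooth_near i x u ->
  derivable (u \o icoord A i) (coord A i x) (delta_mx 0 a).
Proof.
by move=> [Q [oO Ox Oi su]]; have [_ /(_ a)[D _]] := su 1%N; exact: D.
Qed.

Lemma pd_near_eq i x a u v : dom A i x -> (\forall y \near x, u y = v y) ->
  pd i a u x = pd i a v x.
Proof. by move=> d uv; apply: near_eq_derive; exact: near_icoord d uv. Qed.

Lemma pd_cst i x a (r : R) : pd i a (fun=> r) x = 0.
Proof. exact: derive_cst. Qed.

Lemma pdD i x a u v : smooth_near i x u -> smooth_near i x v ->
  pd i a (fun y => u y + v y) x = pd i a u x + pd i a v x.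
Proof. by move=> su sv; apply: deriveD; exact: smooth_near_derivable. Qed.

Lemma pdM i x a u v : dom A i x -> smooth_near i x u -> smooth_near i x v ->
  pd i a (fun y => u y * v y) x = u x * pd i a v x + v x * pd i a u x.
Proof.
move=> d su sv.
have := deriveM (smooth_near_derivable (a := a) su) (smooth_near_derivable (a := a) sv).
by rewrite /= coordK.
Qed.

Lemma pdZ i x a (r : R) u : dom A i x -> smooth_near i x u ->
  pd i a (fun y => r * u y) x = r * pd i a u x.
Proof.
by move=> d su; rewrite (pdM a d (smooth_near_cst r d) su) pd_cst mulr0 addr0.
Qed.

Lemma pdB i x a u v : dom A i x -> smooth_near i x u -> smooth_near i x v ->
  pd i a (fun y => u y - v y) x = pd i a u x - pd i a v x.
Proof. by move=> d su sv; apply: deriveB; exact: smooth_near_derivable. Qed.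

Lemma pd_sum i x a (I : Type) (r : seq I) (P : pred I) (F : I -> M -> R) :
  dom A i x -> (forall k, P k -> smooth_near i x (F k)) ->
  pd i a (fun y => \sum_(k <- r | P k) F k y) x =
  \sum_(k <- r | P k) pd i a (F k) x.
Proof.
move=> d sF; elim: r => [|k r IH].
  by rewrite big_nil; under eq_fun do rewrite big_nil; exact: pd_cst.
rewrite big_cons; under eq_fun do rewrite big_cons.
case: (boolP (P k)) => [Pk|_] //.
by rewrite pdD ?IH//; [exact: sF|exact: smooth_near_sum].
Qed.

Lemma pd_powR i x a u (p : R) : u x != 0 -> dom A i x -> smooth_near i x u ->
  pd i a (fun y => `|u y| `^ p) x = p * (`|u x| `^ p * (u x)^-1) * pd i a u x.
Proof.
move=> u0 d su.
have D := is_derive_absV_powR p u0.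
rewrite -[in X in is_derive X](coordK d) in D.
by have [_ e] := derive_comp1 (smooth_near_derivable (a := a) su) D; rewrite [LHS]e.
Qed.

Lemma pd_comm i x a b u : dom A i x -> smooth_near i x u ->
  pd i a (pd i b u) x = pd i b (pd i a u) x.
Proof.
move=> d [Q [oO Ox Oi su]].
have E c e : pd i c (pd i e u) x = 'D_(delta_mx 0 c)
    (fun z => 'D_(delta_mx 0 e) (u \o icoord A i) z) (coord A i x).
  apply: near_eq_derive; apply: filterS (near_img d) => z /coordK_img zK.
  by rewrite /pd /= zK.
by rewrite !E (pderiv_comm _ _ oO Ox (su 2)).
Qed.

Lemma pd_coord i x a b : dom A i x ->
  pd i a (fun y => coord A i y 0 b) x = (a == b)%:R.
Proof.
move=> d; have -> : pd i a (fun y => coord A i y 0 b) x =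
    'D_(delta_mx 0 a) (fun z : 'rV[R]_n => z 0 b) (coord A i x).
  apply: near_eq_derive; apply: filterS (near_img d) => z /coordK_img zK.
  by rewrite /= zK.
apply: (@derive_val _ _ _ _ _ _ _ ((is_derive_line _ _ _ _).2 _)).
set c := (a == b)%:R; set t := coord A i x 0 b.
have -> : (fun h : R => (h *: delta_mx 0 a + coord A i x) 0 b) =
    (fun h => c *: h + t).
  by apply/funext => h; rewrite !mxE eqxx /= eq_sym mulrC.
by apply: is_derive_eq; rewrite /GRing.scale /= mulr1 addr0.
Qed.

Lemma smooth_near_coord i j x b : dom A i x -> dom A j x ->
  smooth_near i x (fun y => coord A j y 0 b).
Proof.
move=> di dj; have s := @trans_smooth _ _ _ A i j b.
have nI : \forall z \near coord A i x, dom A j (icoord A i z).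
  exact: near_icoord (near_dom dj).
have [W [oW Wx] HW] : exists2 W, open_nbhs (coord A i x) W &
    W `<=` (coord A i @` dom A i) `&` [set z | dom A j (icoord A i z)].
  by apply: near_open; exact: filterI (near_img di) nI.
exists W; split=> // [z /HW[]//|].
apply: smooth_sub s => z /HW[[y dy <-]] /=; rewrite coordK// => dy'.
by exists y.
Qed.

Lemma smooth_near_jac i j x a b : dom A i x -> dom A j x ->
  smooth_near i x (fun y => jac i j y a b).
Proof.
move=> di dj; under eq_fun do rewrite mxE.
by apply: smooth_near_pd; exact: smooth_near_coord.
Qed.

(** Near [x] the expression of [u] in chart [i] is its expression in chart [j] composed with the
    transition map [Phi], so both claims come from the chain rule. *)
Lemma smooth_near_chart i j x u : dom A i x -> dom A j x ->
  smooth_near j x u ->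
  smooth_near i x u /\
  forall a, pd i a u x = \sum_b jac i j x a b * pd j b u x.
Proof.
move=> di dj [W [oW Wx Wj su]].
have nx : \forall y \near x, dom A j y /\ W (coord A j y).
  apply: filterI (near_dom dj) _; apply: (Defs.coord_continuous dj).
  exact: open_nbhs_nbhs.
(* The composition lemma needs [Phi] to be smooth on a whole neighbourhood, not merely at the image
   of [x]. *)
have ncrd : \forall y \near x, forall b, smooth_near i y (fun y => coord A j y 0 b).
  apply: (@filter_forall _ _ _ (nbhs x)) => b.
  by apply: smooth_near_near => //; exact: smooth_near_coord.
have [Q [oO Ox] HO] : exists2 Q, open_nbhs (coord A i x) Q &
    Q `<=` (coord A i @` dom A i) `&`
      [set z | (dom A j (icoord A i z) /\ W (coord A j (icoord A i z))) /\
        forall b, smooth_near i (icoord A i z) (fun y => coord A j y 0 b)].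
  apply: near_open; apply: filterI (near_img di) _.
  exact: (near_icoord (P := fun y => (dom A j y /\ W (coord A j y)) /\
    forall b, smooth_near i y (fun y => coord A j y 0 b)) di (filterI nx ncrd)).
pose Phi z := coord A j (icoord A i z).
have uE : {in Q, (u \o icoord A j) \o Phi =1 u \o icoord A i}.
  by move=> z; rewrite inE => /HO[_ [[dz _] _]]; rewrite /Phi /= coordK.
split.
  exists Q; split=> // [z /HO[]//|k].
  apply: Ck_eq uE _ => //; apply: (Ck_comp oO oW _ _ (su k)).
    by move=> z /HO[_ [[]]].
  move=> b; apply: Ck_local => z Oz; have [[y dy yz] [_ /(_ b)]] := HO _ Oz.
  rewrite -yz coordK// => -[V [oV Vy _ sV]]; by exists V.
move=> a; rewrite /pd -(near_eq_derive _ (open_near_eq oO Ox uE)).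
have dPhi b : derivable (fun z => Phi z 0 b) (coord A i x) (delta_mx 0 a).
  by apply: (smooth_near_derivable (a := a) (u := fun y => coord A j y 0 b));
     exact: smooth_near_coord.
have PhiE : Phi (coord A i x) = coord A j x by rewrite /Phi coordK.
have dF : differentiable (u \o icoord A j) (Phi (coord A i x)).
  by rewrite PhiE; exact: C1_differentiable oW Wx (su 1%N).
have [_ ->] := chain_rule dPhi dF.
by rewrite PhiE; apply: eq_bigr => b _; rewrite mxE.
Qed.

(** This is the chain rule through chart [j] for the coordinate functions of chart [i]. *)
Lemma jacK i j x : dom A i x -> dom A j x -> jac i j x *m jac j i x = 1%:M.
Proof.
move=> di dj; apply/matrixP => a c; rewrite !mxE -(pd_coord a c di).
have [_ ->] := smooth_near_chart di dj (smooth_near_coord c dj di).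
by apply: eq_bigr => b _; rewrite !mxE.
Qed.

End ManifoldCalculus.

(** * Matrix-valued functions *)

Section MatrixCalculus.
Context {R : realType} {n : nat} {M : topologicalType}.
Variable A : smooth_atlas R n M.
Implicit Types (i j : idx A) (x : M) (a : 'I_n).

Definition smooth_mx i x p q (F : M -> 'M[R]_(p, q)) : Prop :=
  forall b c, smooth_near i x (fun y => F y b c).

Definition pdmx i a p q (F : M -> 'M[R]_(p, q)) (x : M) : 'M[R]_(p, q) :=
  \matrix_(b, c) pd i a (fun y => F y b c) x.

Lemma smooth_mxM i x p q r (F : M -> 'M[R]_(p, q)) (H : M -> 'M[R]_(q, r)) :
  dom A i x -> smooth_mx i x F -> smooth_mx i x H ->
  smooth_mx i x (fun y => F y *m H y).
Proof.
move=> d sF sH b c; under eq_fun do rewrite mxE.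
by apply: smooth_near_sum => // k _; exact: smooth_nearM.
Qed.

Lemma smooth_mxT i x p q (F : M -> 'M[R]_(p, q)) :
  smooth_mx i x F -> smooth_mx i x (fun y => (F y)^T).
Proof. by move=> sF b c; under eq_fun do rewrite mxE; exact: sF. Qed.

Lemma smooth_mxD i x p q (F H : M -> 'M[R]_(p, q)) :
  smooth_mx i x F -> smooth_mx i x H -> smooth_mx i x (fun y => F y + H y).
Proof.
by move=> sF sH b c; under eq_fun do rewrite mxE; exact: smooth_nearD.
Qed.

Lemma smooth_mxB i x p q (F H : M -> 'M[R]_(p, q)) : dom A i x ->
  smooth_mx i x F -> smooth_mx i x H -> smooth_mx i x (fun y => F y - H y).
Proof.
move=> d sF sH b c; under eq_fun do rewrite !mxE.
exact: (smooth_nearB d (sF b c) (sH b c)).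
Qed.

Lemma smooth_mxZ i x p q (u : M -> R) (F : M -> 'M[R]_(p, q)) :
  smooth_near i x u -> smooth_mx i x F -> smooth_mx i x (fun y => u y *: F y).
Proof.
by move=> su sF b c; under eq_fun do rewrite mxE; exact: smooth_nearM.
Qed.

Lemma smooth_mx_pdmx i x a p q (F : M -> 'M[R]_(p, q)) :
  smooth_mx i x F -> smooth_mx i x (pdmx i a F).
Proof.
by move=> sF b c; under eq_fun do rewrite mxE; exact: smooth_near_pd.
Qed.

Lemma smooth_mx_block i x p q r s (F1 : M -> 'M[R]_(p, q)) (F2 : M -> 'M[R]_(p, r))
  (F3 : M -> 'M[R]_(s, q)) (F4 : M -> 'M[R]_(s, r)) :
  smooth_mx i x F1 -> smooth_mx i x F2 -> smooth_mx i x F3 -> smooth_mx i x F4 ->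
  smooth_mx i x (fun y => block_mx (F1 y) (F2 y) (F3 y) (F4 y)).
Proof.
move=> s1 s2 s3 s4 b c; case: (split_ordP b) => b' ->; case: (split_ordP c) => c' ->.
- by under eq_fun do rewrite block_mxEul.
- by under eq_fun do rewrite block_mxEur.
- by under eq_fun do rewrite block_mxEdl.
- by under eq_fun do rewrite block_mxEdr.
Qed.

Lemma smooth_mx_cst i x p q (F : 'M[R]_(p, q)) : dom A i x ->
  smooth_mx i x (fun=> F).
Proof. by move=> d b c; exact: smooth_near_cst. Qed.

Lemma smooth_mx_eq i x p q (F H : M -> 'M[R]_(p, q)) : dom A i x ->
  (\forall y \near x, F y = H y) -> smooth_mx i x F -> smooth_mx i x H.
Proof.
move=> d FH sF b c; apply: smooth_near_eq (sF b c) => //.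
by apply: filterS FH => y ->.
Qed.

Lemma pdmx_eq i x a p q (F H : M -> 'M[R]_(p, q)) : dom A i x ->
  (\forall y \near x, F y = H y) -> pdmx i a F x = pdmx i a H x.
Proof.
move=> d FH; apply/matrixP => b c; rewrite !mxE; apply: pd_near_eq => //.
by apply: filterS FH => y ->.
Qed.

Lemma pdmxD i x a p q (F H : M -> 'M[R]_(p, q)) :
  smooth_mx i x F -> smooth_mx i x H ->
  pdmx i a (fun y => F y + H y) x = pdmx i a F x + pdmx i a H x.
Proof.
move=> sF sH; apply/matrixP => b c; rewrite !mxE -pdD//.
by under eq_fun do rewrite mxE.
Qed.

Lemma pdmxB i x a p q (F H : M -> 'M[R]_(p, q)) : dom A i x ->
  smooth_mx i x F -> smooth_mx i x H ->
  pdmx i a (fun y => F y - H y) x = pdmx i a F x - pdmx i a H x.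
Proof.
move=> d sF sH; apply/matrixP => b c; rewrite !mxE -pdB//.
by under eq_fun do rewrite !mxE.
Qed.

Lemma pdmxM i x a p q r (F : M -> 'M[R]_(p, q)) (H : M -> 'M[R]_(q, r)) :
  dom A i x -> smooth_mx i x F -> smooth_mx i x H ->
  pdmx i a (fun y => F y *m H y) x = pdmx i a F x *m H x + F x *m pdmx i a H x.
Proof.
move=> d sF sH; apply/matrixP => b c; rewrite !mxE.
under eq_fun do rewrite mxE.
rewrite pd_sum//; last by move=> k _; exact: smooth_nearM.
rewrite -big_split; apply: eq_bigr => k _ /=.
by rewrite pdM// !mxE addrC [H x k c * _]mulrC.
Qed.

Lemma pdmxZ i x a p q (u : M -> R) (F : M -> 'M[R]_(p, q)) : dom A i x ->
  smooth_near i x u -> smooth_mx i x F ->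
  pdmx i a (fun y => u y *: F y) x = pd i a u x *: F x + u x *: pdmx i a F x.
Proof.
move=> d su sF; apply/matrixP => b c; rewrite !mxE.
under eq_fun do rewrite mxE.
by rewrite pdM// addrC [F x b c * _]mulrC.
Qed.

Lemma pdmxT i x a p q (F : M -> 'M[R]_(p, q)) :
  pdmx i a (fun y => (F y)^T) x = (pdmx i a F x)^T.
Proof.
apply/matrixP.
move=> b c.
rewrite [LHS]mxE.
rewrite [RHS]mxE.
rewrite [RHS]mxE.
by congr (pd i a _ x); apply/funext => y; rewrite mxE.
Qed.

Lemma pdmx_comm i x a (b : 'I_n) p q (F : M -> 'M[R]_(p, q)) : dom A i x ->
  smooth_mx i x F -> pdmx i a (pdmx i b F) x = pdmx i b (pdmx i a F) x.
Proof.
move=> d sF; apply/matrixP => c e.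
have E k : (fun y => pdmx i k F y c e) = pd i k (fun y => F y c e).
  by apply/funext => y; rewrite mxE.
rewrite [LHS]mxE [RHS]mxE (E a) (E b).
exact: pd_comm.
Qed.

Lemma pdmx_chart i j x a p q (F : M -> 'M[R]_(p, q)) :
  dom A i x -> dom A j x -> smooth_mx j x F ->
  pdmx i a F x = \sum_b jac i j x a b *: pdmx j b F x.
Proof.
move=> di dj sF; apply/matrixP => c e; rewrite summxE !mxE.
have [_ ->] := smooth_near_chart di dj (sF c e).
by apply: eq_bigr => b _; rewrite !mxE.
Qed.

(** The differentiated factor is singled out by its index, hence the sequence of indices must be
    duplicate-free. *)
Lemma pd_prod i x a (I : eqType) (r : seq I) (F : I -> M -> R) :
  dom A i x -> uniq r -> (forall k, smooth_near i x (F k)) ->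
  pd i a (fun y => \prod_(k <- r) F k y) x =
  \sum_(l <- r) \prod_(k <- r) (if k == l then pd i a (F k) x else F k x).
Proof.
move=> d ur sF; elim: r ur => [|k r IH] /=.
  by rewrite big_nil; under eq_fun do rewrite big_nil; rewrite pd_cst.
move=> /andP[kr ur]; rewrite big_cons; under eq_fun do rewrite big_cons.
rewrite pdM//; last exact: smooth_near_prod.
rewrite IH// big_cons eqxx addrC mulrC; congr (_ * _ + _).
  by apply: eq_big_seq => l lr; rewrite ifN//; apply: contraNneq kr => <-.
rewrite mulr_sumr; apply: eq_big_seq => l lr; rewrite big_cons ifN//.
by apply: contraNneq kr => ->.
Qed.

Lemma smooth_near_det i x p (F : M -> 'M[R]_p) : dom A i x -> smooth_mx i x F ->
  smooth_near i x (fun y => \det (F y)).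
Proof.
move=> d sF; apply: smooth_near_sum => // s _.
by apply: smooth_nearZ => //; apply: smooth_near_prod.
Qed.

(** Jacobi's formula. By the Leibniz rule the derivative is the sum of the determinants in which one
    row is differentiated; expanding along that row produces the cofactors of [F]. *)
Lemma pd_det i x a p (F : M -> 'M[R]_p) : dom A i x -> smooth_mx i x F ->
  pd i a (fun y => \det (F y)) x = \tr (pdmx i a F x *m \adj (F x)).
Proof.
move=> d sF.
pose H b := \matrix_(c, e) (if c == b then pdmx i a F x c e else F x c e).
transitivity (\sum_b \det (H b)).
  rewrite [LHS]pd_sum// => [|s _]; last first.
    by apply: smooth_nearZ => //; apply: smooth_near_prod.
  rewrite exchange_big /=; apply: eq_bigr => s _.
  rewrite pdZ//; last exact: smooth_near_prod.
  rewrite pd_prod ?index_enum_uniq// mulr_sumr; apply: eq_bigr => b _; congr (_ * _).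
  by apply: eq_bigr => c _; rewrite !mxE.
apply: eq_bigr => b _; rewrite (expand_det_row _ b) [RHS]mxE.
apply: eq_bigr => c _; rewrite !mxE eqxx; congr (_ * (_ * \det _)).
by apply/matrixP => e f; rewrite !mxE eq_sym (negPf (neq_lift _ _)).
Qed.

End MatrixCalculus.

(** * Levi-Civita connection and the density of the metric *)

(* The hypothesis is d_a d_b h = d_b d_a h, given d_c h = Cc h + h Cc^T. *)
Lemma skew_identity (R : realFieldType) n (Ca Cb Da Db h : 'M[R]_n) :
  Da *m h + Cb *m (Ca *m h + h *m Ca^T) + ((Ca *m h + h *m Ca^T) *m Cb^T + h *m Da^T)
  = Db *m h + Ca *m (Cb *m h + h *m Cb^T)
    + ((Cb *m h + h *m Cb^T) *m Ca^T + h *m Db^T) ->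
  (Da - Db + (Cb *m Ca - Ca *m Cb)) *m h
    + h *m (Da - Db + (Cb *m Ca - Ca *m Cb))^T = 0.
Proof.
have -> : (Da - Db + (Cb *m Ca - Ca *m Cb))^T =
    Da^T - Db^T + (Ca^T *m Cb^T - Cb^T *m Ca^T).
  by rewrite [LHS]linearD linearB linearB /= !trmx_mul.
rewrite !mulmxDl !mulmxDr !mulNmx !mulmxN !mulmxA.
(* With every matrix product made an atom, the identity is linear entry by entry. *)
move: (Cb *m Ca *m h) (Cb *m h *m Ca^T) (Ca *m h *m Cb^T) (h *m Ca^T *m Cb^T)
  (Ca *m Cb *m h) (h *m Cb^T *m Ca^T) (Da *m h) (Db *m h) (h *m Da^T)
  (h *m Db^T) => m1 m2 m3 m4 m5 m6 m7 m8 m9 m10 e.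
apply/matrixP => k l; move/matrixP: e => /(_ k l); rewrite !mxE => e; lra.
Qed.

Section MetricGeometry.
Context {R : realType} {n : nat} {M : topologicalType}.
Context {A : smooth_atlas R n M}.
Variables (g : idx A -> M -> 'M[R]_n) (G : idx A -> 'I_n -> 'I_n -> 'I_n -> M -> R).
Hypotheses (g_metric : metric g) (G_LC : levi_civita g G).
Implicit Types (i j : idx A) (x : M) (a b c e : 'I_n).

(* (christoffel_mx i a)_bc = Gamma^c_ab, so that nabla_a acts on columns of
   components of 1-forms as d_a - christoffel_mx i a. *)
Definition christoffel_mx i a x : 'M[R]_n := \matrix_(b, c) G i c a b x.

(** In this layout [v *m riem_mx i a b x] is the curvature operator applied to a vector [v], whereas
    1-forms are contracted with the transpose. *)
Definition riem_mx i a b x : 'M[R]_n := \matrix_(c, e) riem G i e c a b x.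

Lemma smooth_christoffel i x a b c : dom A i x -> smooth_near i x (G i c a b).
Proof.
move=> d; have [[sG _] _ _] := G_LC.
exact: (iffLR (smooth_onP _ _) (sG i c a b) x d).
Qed.

Lemma smooth_christoffel_mx i a x : dom A i x -> smooth_mx i x (christoffel_mx i a).
Proof.
move=> d b c; rewrite /christoffel_mx; under eq_fun do rewrite mxE.
exact: smooth_christoffel.
Qed.

Lemma smooth_metric i x : dom A i x -> smooth_mx i x (g i).
Proof.
move=> d b c; have [sg _ _ _] := g_metric.
exact: (iffLR (smooth_onP _ _) (sg i b c) x d).
Qed.

Lemma tr_metric i x : dom A i x -> (g i x)^T = g i x.
Proof. by have [_ + _ _] := g_metric; apply. Qed.

Lemma metric_unit i x : dom A i x -> g i x \in unitmx.
Proof. by have [_ _ _] := g_metric; apply. Qed.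

Lemma metric_trans i j x : dom A i x -> dom A j x ->
  g i x = jac i j x *m g j x *m (jac i j x)^T.
Proof. by have [_ _ + _] := g_metric; apply. Qed.

Lemma det_metric_neq0 i x : dom A i x -> \det (g i x) != 0.
Proof. by move/metric_unit; rewrite unitmxE unitfE. Qed.

Lemma pdmx_metric i x a : dom A i x ->
  pdmx i a (g i) x =
  christoffel_mx i a x *m g i x + g i x *m (christoffel_mx i a x)^T.
Proof.
move=> d; apply/matrixP => b c; have [_ _ /(_ i x d a b c)] := G_LC.
rewrite /nabla2 mul0r mul0r addr0 => /eqP; rewrite -addrA -opprD subr_eq0.
move=> /eqP e; rewrite [LHS]mxE e [RHS]mxE; congr (_ + _).
  by rewrite mxE; apply: eq_bigr => k _; rewrite !mxE.
by rewrite mxE; apply: eq_bigr => k _; rewrite !mxE mulrC.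
Qed.

(** The upper index of the Christoffel symbol labels the columns, so operators compose from left to
    right and the commutator appears in reversed order. *)
Lemma riem_mxE i x a b : dom A i x ->
  riem_mx i a b x = pdmx i a (christoffel_mx i b) x - pdmx i b (christoffel_mx i a) x
    + (christoffel_mx i b x *m christoffel_mx i a x
       - christoffel_mx i a x *m christoffel_mx i b x).
Proof.
move=> d; apply/matrixP => c e.
have E k : (fun y => christoffel_mx i k y c e) = G i e k c.
  by apply/funext => y; rewrite mxE.
rewrite !mxE (E a) (E b) /riem -sumrB; congr (_ + _); apply: eq_bigr => k _.
by rewrite !mxE mulrC [X in _ - X]mulrC.
Qed.

(** Skewness of the curvature with lowered index: it is what the symmetry of the second derivatives
    of [g] says once they are computed from [pdmx_metric]. *)
Lemma riem_mx_skew i x a b : dom A i x ->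
  riem_mx i a b x *m g i x + g i x *m (riem_mx i a b x)^T = 0.
Proof.
move=> d.
have dd k l : pdmx i k (pdmx i l (g i)) x =
    pdmx i k (christoffel_mx i l) x *m g i x
    + christoffel_mx i l x *m
       (christoffel_mx i k x *m g i x + g i x *m (christoffel_mx i k x)^T)
    + ((christoffel_mx i k x *m g i x + g i x *m (christoffel_mx i k x)^T)
         *m (christoffel_mx i l x)^T
       + g i x *m (pdmx i k (christoffel_mx i l) x)^T).
  have -> : pdmx i k (pdmx i l (g i)) x = pdmx i k (fun y =>
      christoffel_mx i l y *m g i y + g i y *m (christoffel_mx i l y)^T) x.
    by apply: pdmx_eq => //; apply: filterS (near_dom d) => y; exact: pdmx_metric.
  have sg := smooth_metric d; have sG := smooth_christoffel_mx l d.
  rewrite pdmxD; [|exact: smooth_mxM|by apply: smooth_mxM => //; exact: smooth_mxT].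
  rewrite !pdmxM//; last exact: smooth_mxT.
  by rewrite pdmxT !pdmx_metric.
have := pdmx_comm a b d (smooth_metric d); rewrite (dd a b) (dd b a) riem_mxE//.
exact: skew_identity.
Qed.

Lemma riem_anti i x e p a b : riem G i e p a b x = - riem G i e p b a x.
Proof.
rewrite /riem opprD opprB -sumrN; congr (_ + _).
by apply: eq_bigr => k _; rewrite opprB.
Qed.

Lemma christoffel_sym i x c a b : dom A i x -> G i c a b x = G i c b a x.
Proof. by have [_ + _] := G_LC; move=> H d; exact: H. Qed.

Lemma pd_christoffel_sym i x k c a b : dom A i x ->
  pd i k (G i c a b) x = pd i k (G i c b a) x.
Proof.
move=> d; apply: pd_near_eq => //.
by apply: filterS (near_dom d) => y dy; exact: christoffel_sym.
Qed.

Lemma bianchi i x e p k l : dom A i x ->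
  riem G i e p k l x + riem G i e k l p x + riem G i e l p k x = 0.
Proof.
move=> d; rewrite /riem !sumrB.
pose Q k l p := \sum_m G i e k m x * G i m l p x.
rewrite -/(Q k l p) -/(Q l k p) -/(Q l p k) -/(Q p l k) -/(Q p k l) -/(Q k p l).
have Qs u v w : Q u v w = Q u w v.
  by apply: eq_bigr => m _; rewrite (christoffel_sym m v w d).
rewrite (Qs k p l) (Qs l p k) (Qs p l k).
rewrite (pd_christoffel_sym k e l p d) (pd_christoffel_sym l e k p d)
  (pd_christoffel_sym p e l k d); ring.
Qed.

(** By skewness [riem_mx] is conjugate, through [g], to minus its transpose. *)
Lemma mxtrace_riem_mx i x a b : dom A i x -> \tr (riem_mx i a b x) = 0.
Proof.
move=> d; have gU := metric_unit d.
have /eqP := riem_mx_skew a b d; rewrite addr_eq0 => /eqP e.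
have /eqP : \tr (riem_mx i a b x) = - \tr (riem_mx i a b x).
  rewrite -[in LHS](mulmxK gU (riem_mx i a b x)) e mulNmx raddfN /=.
  by rewrite mxtrace_mulC mulmxA mulVmx// mul1mx mxtrace_tr.
by rewrite -addr_eq0 -mulr2n mulrn_eq0 => /eqP.
Qed.

(** By the Bianchi identity the skew part of the Ricci tensor is a trace of the curvature, which
    vanishes by [mxtrace_riem_mx]. *)
Lemma ricci_sym i x p k : dom A i x -> ricci G i p k x = ricci G i k p x.
Proof.
move=> d; apply/eqP; rewrite -subr_eq0 /ricci -sumrB.
have -> : \sum_a (riem G i a p a k x - riem G i a k a p x) =
    - \tr (riem_mx i k p x).
  rewrite -sumrN; apply: eq_bigr => a _; rewrite mxE.
  have := bianchi a p a k d; rewrite (riem_anti i x a k p a) => e.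
  by apply/eqP; rewrite -subr_eq0 -[X in _ == X]e; apply/eqP; ring.
by rewrite mxtrace_riem_mx// oppr0.
Qed.

Lemma conn1E i a x : conn1 G i a x = \tr (christoffel_mx i a x) / n.+1%:R.
Proof. by congr (_ / _); apply: eq_bigr => c _; rewrite mxE. Qed.

Lemma tau_g_gt0 i x : dom A i x -> 0 < tau_g g i x.
Proof. by move=> d; rewrite powR_gt0// normr_gt0 det_metric_neq0. Qed.

Lemma smooth_tau_g i x : dom A i x -> smooth_near i x (tau_g g i).
Proof.
move=> d; apply: smooth_near_powR => //; first exact: det_metric_neq0.
by apply: smooth_near_det => //; exact: smooth_metric.
Qed.

(** This says that [tau_g] is parallel in E(2). With [pdmx_metric], Jacobi's formula gives twice the
    trace of the Christoffel matrix as logarithmic derivative of det g, and the exponent -1/(n+1)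
    turns it into -2 [conn1]. *)
Lemma pd_tau_g i x a : dom A i x ->
  pd i a (tau_g g i) x = - (2 * conn1 G i a x * tau_g g i x).
Proof.
move=> d; have d0 := det_metric_neq0 d.
rewrite /tau_g pd_powR//; last by apply: smooth_near_det => //; exact: smooth_metric.
rewrite pd_det//; last exact: smooth_metric.
rewrite pdmx_metric// mulmxDl mxtraceD -!mulmxA mul_mx_adj.
rewrite [X in _ + X]mxtrace_mulC -mulmxA mul_adj_mx.
rewrite !mul_mx_scalar !mxtraceZ mxtrace_tr conn1E.
field; rewrite d0 /=; apply/andP; split=> //.
Qed.

(** The determinant of the metric changes by the square of the Jacobian determinant, which accounts
    for the weight 2. *)
Lemma tau_g_trans i j x : dom A i x -> dom A j x ->
  tau_g g i x = dens 2 i j x * tau_g g j x.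
Proof.
move=> di dj; rewrite /tau_g /dens (metric_trans di dj) 2!det_mulmx det_tr.
rewrite !normrM mulrAC powRM// -expr2 -(powR_mulrn 2)// -powRrM mulrN.
by congr (_ * _).
Qed.

End MetricGeometry.

(** * Covariant derivatives of weighted tensors, and their behaviour under change of chart *)

Section MetricGeometry.
Context {R : realType} {n : nat} {M : topologicalType}.
Context {A : smooth_atlas R n M}.
Variables (g : idx A -> M -> 'M[R]_n) (G : idx A -> 'I_n -> 'I_n -> 'I_n -> M -> R).
Hypotheses (g_metric : metric g) (G_LC : levi_civita g G).
Implicit Types (i j : idx A) (x : M) (a b c e : 'I_n) (f : M -> R).

Local Notation christoffel_mx := (christoffel_mx G).
Local Notation tau := (tau_g g).
Local Notation grad f := (nabla0 G 0 (fun=> f)).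
Local Notation hess f := (nabla1 G 0 (grad f)).

Lemma smooth_mx_chart i j x p q (F : M -> 'M[R]_(p, q)) :
  dom A i x -> dom A j x -> smooth_mx j x F -> smooth_mx i x F.
Proof. by move=> di dj sF b c; have [] := smooth_near_chart di dj (sF b c). Qed.

Lemma row_nabla1 w m i x a : row a (nabla1 G w m i x) =
  pdmx i a (m i) x - m i x *m (christoffel_mx i a x)^T + (w * conn1 G i a x) *: m i x.
Proof.
apply/rowP => b; rewrite !mxE; congr (_ - _ + _).
by apply: eq_bigr => c _; rewrite !mxE mulrC.
Qed.

Lemma nabla2E w r i x a b c : nabla2 G w r i x a b c =
  (pdmx i a (r i) x - christoffel_mx i a x *m r i x
    - r i x *m (christoffel_mx i a x)^T + (w * conn1 G i a x) *: r i x) b c.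
Proof.
rewrite !mxE /nabla2; congr (_ - _ - _ + _).
  by apply: eq_bigr => k _; rewrite !mxE.
by apply: eq_bigr => k _; rewrite !mxE mulrC.
Qed.

Lemma nabla0_eq w s s' i x : dom A i x ->
  (\forall y \near x, s i y = s' i y) -> nabla0 G w s i x = nabla0 G w s' i x.
Proof.
move=> d ss; apply/rowP => a; rewrite !mxE (nbhs_singleton ss).
by congr (_ + _); exact: pd_near_eq.
Qed.

Lemma nabla1_eq w m m' i x : dom A i x ->
  (\forall y \near x, m i y = m' i y) -> nabla1 G w m i x = nabla1 G w m' i x.
Proof.
move=> d mm; apply/row_matrixP => a; rewrite !row_nabla1 (nbhs_singleton mm).
by rewrite (pdmx_eq a d mm).
Qed.

Lemma nabla2_eq w r r' i x a b c : dom A i x ->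
  (\forall y \near x, r i y = r' i y) ->
  nabla2 G w r i x a b c = nabla2 G w r' i x a b c.
Proof.
by move=> d rr; rewrite !nabla2E (nbhs_singleton rr) (pdmx_eq a d rr).
Qed.

(** Multiplication by the parallel section [tau_g] intertwines the derivatives of weight 0 and of
    weight 2; the next two lemmas are the same fact for higher valence. *)
Lemma nabla0_tau u i x : dom A i x -> smooth_near i x u ->
  nabla0 G 2 (fun k y => u y * tau k y) i x = tau i x *: grad u i x.
Proof.
move=> d su; apply/rowP => a; rewrite !mxE.
rewrite pdM//; last exact: smooth_tau_g.
by rewrite (pd_tau_g g_metric G_LC)//; ring.
Qed.

Lemma nabla1_tau m i x : dom A i x -> smooth_mx i x (m i) ->
  nabla1 G 2 (fun k y => tau k y *: m k y) i x = tau i x *: nabla1 G 0 m i x.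
Proof.
move=> d sm; have st := smooth_tau_g g_metric d.
apply/row_matrixP => a; rewrite linearZ /= !row_nabla1 pdmxZ//.
rewrite (pd_tau_g g_metric G_LC)// -scalemxAl mul0r scale0r addr0.
by apply/rowP => b; rewrite !mxE; ring.
Qed.

Lemma nabla2_tau r i x a b c : dom A i x -> smooth_mx i x (r i) ->
  nabla2 G 2 (fun k y => tau k y *: r k y) i x a b c =
  tau i x * nabla2 G 0 r i x a b c.
Proof.
move=> d sr; have st := smooth_tau_g g_metric d.
rewrite !nabla2E pdmxZ// (pd_tau_g g_metric G_LC)// -scalemxAl -scalemxAr.
by rewrite !mxE; ring.
Qed.

Lemma gradE f i x a : grad f i x 0 a = pd i a f x.
Proof. by rewrite mxE !mul0r addr0. Qed.

Lemma smooth_grad f i x : smooth_near i x f -> smooth_mx i x (grad f i).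
Proof.
move=> sf b c; rewrite ord1; under eq_fun do rewrite gradE.
exact: smooth_near_pd.
Qed.

Lemma smooth_nabla1 m i x : dom A i x -> smooth_mx i x (m i) ->
  smooth_mx i x (nabla1 G 0 m i).
Proof.
move=> d sm b c.
have E y : nabla1 G 0 m i y b c =
    (pdmx i b (m i) y - m i y *m (christoffel_mx i b y)^T) 0 c.
  have := row_nabla1 0 m i y b; rewrite mul0r scale0r addr0 => <-.
  by rewrite [RHS]mxE.
under eq_fun do rewrite E.
apply: smooth_mxB => //; first exact: smooth_mx_pdmx.
apply: smooth_mxM => //; apply: smooth_mxT; exact: smooth_christoffel_mx G_LC _ _ _ d.
Qed.

Lemma grad_trans f i j x : dom A i x -> dom A j x -> smooth_near j x f ->
  grad f i x = grad f j x *m (jac i j x)^T.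
Proof.
move=> di dj sf; apply/rowP => a; rewrite gradE !mxE.
have [_ ->] := smooth_near_chart di dj sf.
by apply: eq_bigr => b _; rewrite gradE [in RHS]mxE mulrC.
Qed.

(** The transformation law of a connection, multiplied by the Jacobian so that no inverse occurs. *)
Lemma christoffel_trans i j x a : dom A i x -> dom A j x ->
  christoffel_mx i a x *m jac i j x =
  \sum_p jac i j x a p *: (jac i j x *m christoffel_mx j p x)
    + pdmx i a (jac i j) x.
Proof.
move=> di dj; have [[_ Gt] _ _] := G_LC.
suff -> : christoffel_mx i a x = (\sum_p jac i j x a p *:
    (jac i j x *m christoffel_mx j p x) + pdmx i a (jac i j) x) *m jac j i x.
  by rewrite -mulmxA jacK// mulmx1.
apply/matrixP => b c; rewrite [LHS]mxE (Gt i j x di dj) [RHS]mxE.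
apply: eq_bigr => k _; rewrite mulrC; congr (_ * _).
rewrite [RHS]mxE summxE; congr (_ + _); last by rewrite mxE.
apply: eq_bigr => p _; rewrite !mxE mulr_sumr; apply: eq_bigr => q _.
by rewrite !mxE mulrA.
Qed.

Lemma hess_trans f i j x : dom A i x -> dom A j x -> smooth_near j x f ->
  hess f i x = jac i j x *m hess f j x *m (jac i j x)^T.
Proof.
move=> di dj sf; apply/row_matrixP => a.
have sgj := smooth_grad sf.
have sgi := smooth_mx_chart di dj sgj.
have sJ : smooth_mx i x (jac i j) by move=> b c; exact: smooth_near_jac.
rewrite !row_mul (mulmx_sum_row (row a (jac i j x))) mulmx_suml.
rewrite row_nabla1 mul0r scale0r addr0.
rewrite (pdmx_eq (H := fun y => grad f j y *m (jac i j y)^T) a di); last first.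
  apply: filterS2 (near_dom di) (filterI (near_dom dj) (smooth_near_near dj sf)).
  by move=> y dyi [dyj sy]; exact: grad_trans.
rewrite pdmxM//; last exact: smooth_mxT.
rewrite (pdmx_chart a di dj sgj) pdmxT (grad_trans di dj sf) -mulmxA -trmx_mul.
(* The derivatives of the Jacobian coming from the gradient and from the Christoffel symbols cancel,
   which leaves a tensorial law. *)
rewrite christoffel_trans// [in X in _ - X]linearD linear_sum /= mulmxDr opprD.
rewrite addrACA subrr addr0 mulmx_suml mulmx_sumr -sumrB; apply: eq_bigr => p _.
rewrite row_nabla1 mul0r scale0r addr0 !mxE linearZ /= trmx_mul.
by rewrite -!scalemxAl -scalemxAr -scalerBr mulmxBl mulmxA.
Qed.

Lemma hess_sym f i x : dom A i x -> smooth_near i x f ->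
  (hess f i x)^T = hess f i x.
Proof.
move=> d sf; apply/matrixP => a b; rewrite !mxE !mul0r !addr0.
have E k : (fun y => grad f i y 0 k) = pd i k f.
  by apply/funext => y; exact: gradE.
rewrite (E a) (E b) pd_comm//; congr (_ - _).
by apply: eq_bigr => c _; rewrite (christoffel_sym G_LC c _ _ d).
Qed.

End MetricGeometry.

(** * Prolongation of the Gallot-Obata-Tanno equation *)

Section Prolongation.
Context {R : realType} {n : nat} {M : topologicalType}.
Context {A : smooth_atlas R n M}.
Variables (g : idx A -> M -> 'M[R]_n) (G : idx A -> 'I_n -> 'I_n -> 'I_n -> M -> R).
Hypotheses (g_metric : metric g) (G_LC : levi_civita g G).
Implicit Types (i j : idx A) (x : M) (a b c e : 'I_n) (f : M -> R).

Local Notation christoffel_mx := (christoffel_mx G).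
Local Notation tau := (tau_g g).
Local Notation grad f := (nabla0 G 0 (fun=> f)).
Local Notation hess f := (nabla1 G 0 (grad f)).

(** Sections vanish outside the chart domains by convention; this enforces it for formulas that make
    sense, but need not vanish, there. *)
Definition extend0 (T : zmodType) (s : idx A -> M -> T) i x : T :=
  if `[< dom A i x >] then s i x else 0.

Lemma extend0T (T : zmodType) (s : idx A -> M -> T) i x : dom A i x ->
  extend0 s i x = s i x.
Proof. by rewrite /extend0 => d; rewrite asboolT. Qed.

Lemma extend0F (T : zmodType) (s : idx A -> M -> T) i x : ~ dom A i x ->
  extend0 s i x = 0.
Proof. by rewrite /extend0 => d; rewrite asboolF. Qed.

Lemma near_extend0 (T : zmodType) (s : idx A -> M -> T) i x : dom A i x ->
  \forall y \near x, s i y = extend0 s i y.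
Proof.
by move=> d; apply: filterS (near_dom d) => y dy; rewrite extend0T.
Qed.

Definition prolong_tau f i x : R := f x * tau i x.
Definition prolong_mu f i x : 'rV[R]_n := tau i x *: (2^-1 *: grad f i x).
Definition prolong_rho B0 f i x : 'M[R]_n :=
  tau i x *: (2^-1 *: hess f i x + (B0 * f x) *: g i x).

Definition prolong B0 f : triple A :=
  (extend0 (prolong_tau f), extend0 (prolong_mu f), extend0 (prolong_rho B0 f)).

Definition got_lhs B0 f i x a b c : R :=
  nabla2 G 0 (hess f) i x a b c
  + B0 * (2 * g i x b c * grad f i x 0 a + g i x a b * grad f i x 0 c
          + g i x c a * grad f i x 0 b).

Lemma smooth_fun_near f i x : smooth_fun A f -> dom A i x -> smooth_near i x f.
Proof. by move=> sf d; exact: (iffLR (smooth_onP _ _) (sf i)). Qed.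

Lemma prolong_eq1 f i x a : smooth_fun A f -> dom A i x ->
  nabla0 G 2 (extend0 (prolong_tau f)) i x 0 a
  - 2 * extend0 (prolong_mu f) i x 0 a = 0.
Proof.
move=> sf d; rewrite extend0T// -(nabla0_eq G 2 d (near_extend0 _ d)).
rewrite (nabla0_tau g_metric G_LC d (smooth_fun_near sf d)) /prolong_mu.
by rewrite !mxE; field.
Qed.

Lemma smooth_half_grad f i x : smooth_fun A f -> dom A i x ->
  smooth_mx i x (fun y => 2^-1 *: grad f i y).
Proof.
move=> sf d; apply: smooth_mxZ; first exact: smooth_near_cst.
exact: smooth_grad (smooth_fun_near sf d).
Qed.

Lemma nabla1_half m i x : dom A i x -> smooth_mx i x (m i) ->
  nabla1 G 0 (fun k y => 2^-1 *: m k y) i x = 2^-1 *: nabla1 G 0 m i x.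
Proof.
move=> d sm; apply/row_matrixP => a; rewrite linearZ /= !row_nabla1 pdmxZ//.
  by rewrite pd_cst scale0r add0r !mul0r !scale0r !addr0 scalerBr scalemxAl.
exact: smooth_near_cst.
Qed.

Lemma prolong_eq2 B0 f i x a b : smooth_fun A f -> dom A i x ->
  nabla1 G 2 (extend0 (prolong_mu f)) i x a b
  + B0 * g i x a b * extend0 (prolong_tau f) i x
  - extend0 (prolong_rho B0 f) i x a b = 0.
Proof.
move=> sf d; rewrite !extend0T// -(nabla1_eq G 2 d (near_extend0 _ d)).
rewrite (nabla1_tau g_metric G_LC d (smooth_half_grad sf d)).
rewrite (nabla1_half d (smooth_grad G (smooth_fun_near sf d))).
rewrite /prolong_tau /prolong_rho.
by move: (hess f i x) (g i x) => h k; rewrite !mxE; ring.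
Qed.

Lemma smooth_rho B0 f i x : smooth_fun A f -> dom A i x ->
  smooth_mx i x (fun y => 2^-1 *: hess f i y + (B0 * f y) *: g i y).
Proof.
move=> sf d; have sf' := smooth_fun_near sf d.
apply: smooth_mxD.
  apply: smooth_mxZ; first exact: smooth_near_cst.
  apply: (smooth_nabla1 G_LC) => //; exact: smooth_grad.
apply: smooth_mxZ; first exact: smooth_nearZ.
exact: smooth_metric.
Qed.

Lemma prolong_eq3 B0 f i x a b c : smooth_fun A f -> dom A i x ->
  nabla2 G 2 (extend0 (prolong_rho B0 f)) i x a b c
  + B0 * (g i x a b * extend0 (prolong_mu f) i x 0 c
          + g i x a c * extend0 (prolong_mu f) i x 0 b) =
  2^-1 * tau i x * got_lhs B0 f i x a b c.
Proof.
move=> sf d; have sf' := smooth_fun_near sf d.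
have sh : smooth_mx i x (hess f i).
  by apply: (smooth_nabla1 G_LC) => //; exact: smooth_grad.
have sg := smooth_metric g_metric d.
rewrite !extend0T// -(nabla2_eq G 2 a b c d (near_extend0 _ d)).
rewrite (nabla2_tau g_metric G_LC a b c d (smooth_rho B0 sf d)).
(* As the metric is parallel, only [f] is differentiated in the product with [g]. *)
have -> : nabla2 G 0 (fun k y => 2^-1 *: hess f k y + (B0 * f y) *: g k y) i x a b c
    = 2^-1 * nabla2 G 0 (hess f) i x a b c + B0 * grad f i x 0 a * g i x b c.
  rewrite !nabla2E pdmxD; first last.
  - by apply: smooth_mxZ => //; exact: smooth_nearZ.
  - by apply: smooth_mxZ => //; exact: smooth_near_cst.
  rewrite !pdmxZ//; [|exact: smooth_near_cst|exact: smooth_nearZ].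
  rewrite pd_cst pdZ// (pdmx_metric G_LC)// !mul0r !scale0r !addr0 add0r.
  rewrite (gradE G f i x a) !mulmxDr !mulmxDl -!scalemxAr -!scalemxAl.
  move: (pdmx i a (hess f i) x) (christoffel_mx i a x *m hess f i x)
    (hess f i x *m (christoffel_mx i a x)^T) (christoffel_mx i a x *m g i x)
    (g i x *m (christoffel_mx i a x)^T) (g i x) => m1 m2 m3 m4 m5 m6.
  by rewrite !mxE; ring.
have gca : g i x c a = g i x a c by rewrite -[in LHS](tr_metric g_metric d) mxE.
rewrite /got_lhs gca /prolong_mu.
move: (nabla2 G 0 _ i x a b c) (grad f i x) (g i x) => h df k.
by rewrite !mxE; field.
Qed.

Lemma prolong_tau_sec f : smooth_fun A f -> Esec 2 (extend0 (prolong_tau f)).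
Proof.
move=> sf; split=> [i|i j x di dj|i x]; last exact: extend0F.
  apply/smooth_onP => x d; apply: smooth_near_eq (near_extend0 _ d) _ => //.
  by apply: smooth_nearM; [exact: smooth_fun_near|exact: smooth_tau_g].
by rewrite !extend0T// /prolong_tau (tau_g_trans g_metric di dj) mulrCA.
Qed.

Lemma prolong_mu_sec f : smooth_fun A f -> T1sec 2 (extend0 (prolong_mu f)).
Proof.
move=> sf; split=> [i a|i j x di dj|i x]; last exact: extend0F.
  apply/smooth_onP => x d.
  apply: (smooth_mx_eq d (near_extend0 (prolong_mu f) d)).
  apply: smooth_mxZ; first exact: smooth_tau_g.
  exact: smooth_half_grad.
rewrite !extend0T// /prolong_mu (tau_g_trans g_metric di dj).
by rewrite (grad_trans G di dj (smooth_fun_near sf dj)) -!scalemxAl !scalerA.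
Qed.

Lemma prolong_rho_sec B0 f : smooth_fun A f -> S2sec 2 (extend0 (prolong_rho B0 f)).
Proof.
move=> sf; split=> [i a b|i x|i j x di dj|i x]; last exact: extend0F.
- apply/smooth_onP => x d.
  apply: (smooth_mx_eq d (near_extend0 (prolong_rho B0 f) d)).
  apply: smooth_mxZ; first exact: smooth_tau_g.
  exact: smooth_rho.
- have [d|d] := pselect (dom A i x); last by rewrite extend0F// trmx0.
  rewrite extend0T// /prolong_rho [LHS]linearZ /= linearD /=.
  rewrite [X in _ *: (X + _)]linearZ /=.
  rewrite [X in _ *: (_ + X)]linearZ /= (hess_sym G_LC d (smooth_fun_near sf d)).
  by rewrite (tr_metric g_metric d).
rewrite !extend0T// /prolong_rho (tau_g_trans g_metric di dj).
rewrite (hess_trans G_LC di dj (smooth_fun_near sf dj)) (metric_trans g_metric di dj).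
rewrite -scalerA; congr (_ *: _); rewrite -scalemxAr -scalemxAl; congr (_ *: _).
by rewrite mulmxDr mulmxDl -!scalemxAr -!scalemxAl.
Qed.

Lemma prolong_system B0 f : got_solution g G B0 f ->
  system_solution g G B0 (prolong B0 f).
Proof.
move=> [sf e]; split; [exact: prolong_tau_sec|exact: prolong_mu_sec
  |exact: prolong_rho_sec|move=> i x d; split=> [a|a b|a b c]].
- exact: prolong_eq1.
- exact: prolong_eq2.
- by rewrite prolong_eq3// /got_lhs e// mulr0.
Qed.

Lemma prolong_got B0 f : smooth_fun A f ->
  system_solution g G B0 (prolong B0 f) -> got_solution g G B0 f.
Proof.
move=> sf [_ _ _ e]; split=> // i x d a b c; have [_ _ /(_ a b c)] := e i x d.
rewrite prolong_eq3// => /eqP; rewrite !mulf_eq0 invr_eq0 pnatr_eq0 /=.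
by rewrite gt_eqF ?(tau_g_gt0 g_metric)// => /eqP.
Qed.

(** The first two equations, which the prolongation satisfies for every smooth [f], can be solved
    for [mu] and [rho]; so triples with the same [tau] agree on chart domains, and elsewhere both
    are zero. *)
Lemma system_prolong B0 f s : smooth_fun A f -> system_solution g G B0 s ->
  corresponds g f s.1.1 -> s = prolong B0 f.
Proof.
case: s => [[t m] r] sf [[_ _ t0] [_ _ m0] [_ _ _ r0] e] /= ft.
have tE : t = extend0 (prolong_tau f).
  apply/funext => i; apply/funext => x; have [d|d] := pselect (dom A i x).
    by rewrite extend0T// ft.
  by rewrite extend0F// t0.
have mE : m = extend0 (prolong_mu f).
  apply/funext => i; apply/funext => x; have [d|d] := pselect (dom A i x).
    apply/rowP => a; have [/(_ a) e1 _ _] := e i x d.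
    have := prolong_eq1 a sf d; rewrite -tE => e2.
    have n2 : (2 : R) != 0 by rewrite pnatr_eq0.
    apply: (mulfI n2); move/eqP: e1; rewrite subr_eq0 => /eqP <-.
    by apply/eqP; rewrite -subr_eq0 e2.
  by rewrite extend0F// m0.
have rE : r = extend0 (prolong_rho B0 f).
  apply/funext => i; apply/funext => x; have [d|d] := pselect (dom A i x).
    apply/matrixP => a b; have [_ /(_ a b) e1 _] := e i x d.
    have := prolong_eq2 B0 a b sf d; rewrite -tE -mE => e2.
    by move: e1 => /eqP; rewrite subr_eq0 => /eqP <-; apply/eqP; rewrite -subr_eq0 e2.
  by rewrite extend0F// r0.
by rewrite tE mE rE.
Qed.

Lemma corresponds_prolong B0 f : corresponds g f (prolong B0 f).1.1.
Proof. by move=> i x d; rewrite /= extend0T. Qed.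

Lemma corresponds_inj f f' t : corresponds g f t -> corresponds g f' t -> f = f'.
Proof.
move=> ft f't; apply/funext => x; have [i d] := dom_cover A x.
have t0 : tau i x != 0 by rewrite gt_eqF// tau_g_gt0.
by move: (ft i x d) (f't i x d); rewrite /tau_of => -> /(mulIf t0).
Qed.

Lemma corresponds_ex t : Esec 2 t -> exists2 f, smooth_fun A f & corresponds g f t.
Proof.
move=> [st tt _].
(* The quotient of two sections of E(2) does not depend on the chart, so at each point any chart
   around it may be chosen; [fE] proves this independence. *)
pose f x := let i := projT1 (cid (dom_cover A x)) in t i x / tau i x.
have fE i x : dom A i x -> f x = t i x / tau i x.
  move=> di; rewrite /f; case: cid => j dj /=.
  rewrite (tt i j x di dj) (tau_g_trans g_metric di dj).
  have d0 : dens 2 i j x != 0.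
    have := tau_g_gt0 g_metric di; rewrite (tau_g_trans g_metric di dj).
    by apply: contraTneq => ->; rewrite mul0r ltxx.
  by rewrite -mulf_div divff// mul1r.
exists f => [i|i x d]; last first.
  by rewrite /tau_of (fE i x d) divfK// gt_eqF// tau_g_gt0.
apply/smooth_onP => x d.
apply: (@smooth_near_eq _ _ _ _ _ _ (fun y => t i y * (tau i y)^-1)) => //.
  by apply: filterS (near_dom d) => y dy; rewrite (fE i y dy).
apply: smooth_nearM; first exact: (iffLR (smooth_onP _ _) (st i)).
apply: smooth_nearV => //; last exact: smooth_tau_g.
by rewrite gt_eqF// tau_g_gt0.
Qed.

Lemma got_system_one_to_one B0 : one_to_one (got_solution g G B0)
  (system_solution g G B0) (fun f s => corresponds g f s.1.1).
Proof.
split=> [f sol|s sol].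
  exists (prolong B0 f); split.
    by split; [exact: prolong_system|exact: corresponds_prolong].
  by move=> s [ss fs]; apply/esym/system_prolong => //; case: sol.
have [st] : Esec 2 s.1.1 /\ True by case: s sol => [[t m] r] [].
move=> _; have [f sf ft] := corresponds_ex st.
exists f; split; last by move=> f' [_ f't]; exact: corresponds_inj f't.
split=> //; apply: prolong_got => //.
by rewrite -(system_prolong sf sol ft).
Qed.

End Prolongation.

(** * Weyl nullity *)

Lemma pair_cancel (R : realFieldType) (B ma mb qa qb ua ub : R) :
  B * (ma * ub - mb * ua) = qb * ma - qa * mb ->
  ma * (qb - B * ub) = mb * (qa - B * ua).
Proof. by move=> h; lra. Qed.

Section Nullity.
Context {R : realType} {n : nat} {M : topologicalType}.
Context {A : smooth_atlas R n M}.
Variables (g : idx A -> M -> 'M[R]_n) (G : idx A -> 'I_n -> 'I_n -> 'I_n -> M -> R).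
Hypotheses (g_metric : metric g) (G_LC : levi_civita g G) (n_ge2 : (2 <= n)%N).
Implicit Types (i j : idx A) (x : M) (a b c e : 'I_n) (f : M -> R).

Local Notation christoffel_mx := (christoffel_mx G).
Local Notation riem_mx := (riem_mx G).
Local Notation tau := (tau_g g).
Local Notation grad f := (nabla0 G 0 (fun=> f)).
Local Notation hess f := (nabla1 G 0 (grad f)).

Lemma ricci_identity (m : idx A -> M -> 'rV[R]_n) i x a b c :
  dom A i x -> smooth_mx i x (m i) ->
  nabla2 G 0 (nabla1 G 0 m) i x a b c - nabla2 G 0 (nabla1 G 0 m) i x b a c =
  - (m i x *m (riem_mx i a b x)^T) 0 c.
Proof.
move=> d sm.
pose D k y := pdmx i k (m i) y - m i y *m (christoffel_mx i k y)^T.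
have DE k y l : nabla1 G 0 m i y k l = D k y 0 l.
  have := row_nabla1 G 0 m i y k; rewrite mul0r scale0r addr0 => /rowP/(_ l).
  by rewrite [LHS]mxE.
have sGT k : smooth_mx i x (fun y => (christoffel_mx i k y)^T).
  by apply: smooth_mxT; exact: smooth_christoffel_mx G_LC _ _ _ d.
have E k l : nabla2 G 0 (nabla1 G 0 m) i x k l c =
    (pdmx i k (D l) x - D l x *m (christoffel_mx i k x)^T) 0 c
    - \sum_e G i e k l x * D e x 0 c.
  rewrite /nabla2 !mul0r addr0 addrAC !mxE; congr (_ - _ - _).
  - by congr (pd i k _ x); apply/funext => y; exact: DE.
  - by apply: eq_bigr => e _; rewrite DE !mxE mulrC.
  - by apply: eq_bigr => e _; rewrite DE.
rewrite (E a b) (E b a).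
(* The terms in which the connection acts on the differentiation index are equal because there is no
   torsion. *)
have -> : \sum_e G i e b a x * D e x 0 c = \sum_e G i e a b x * D e x 0 c.
  by apply: eq_bigr => e _; rewrite (christoffel_sym G_LC e a b d).
have pdD k l : pdmx i k (D l) x = pdmx i k (pdmx i l (m i)) x
    - (pdmx i k (m i) x *m (christoffel_mx i l x)^T
       + m i x *m (pdmx i k (christoffel_mx i l) x)^T).
  rewrite /D pdmxB//; [|exact: smooth_mx_pdmx|exact: smooth_mxM].
  by rewrite pdmxM// pdmxT.
rewrite (pdD a b) (pdD b a) (pdmx_comm a b d sm) (riem_mxE G a b d) /D.
move: (christoffel_mx i a x) (christoffel_mx i b x) (pdmx i a (christoffel_mx i b) x)
  (pdmx i b (christoffel_mx i a) x) (pdmx i a (m i) x) (pdmx i b (m i) x) (m i x)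
  (pdmx i b (pdmx i a (m i)) x) (\sum_e _) => Ca Cb Dab Dba ma mb m0 mab S.
have -> : (Dab - Dba + (Cb *m Ca - Ca *m Cb))^T =
    Dab^T - Dba^T + (Ca^T *m Cb^T - Cb^T *m Ca^T).
  by rewrite [LHS]linearD linearB linearB /= !trmx_mul.
rewrite !mulmxBl !mulmxDr !mulmxN !mulmxA.
move: (ma *m Cb^T) (m0 *m Dab^T) (mb *m Ca^T) (m0 *m Dba^T)
  (m0 *m Ca^T *m Cb^T) (m0 *m Cb^T *m Ca^T) => m1 m2 m3 m4 m5 m6.
by rewrite !mxE; ring.
Qed.

Lemma got_riem B0 f i x a b : got_solution g G B0 f -> dom A i x ->
  grad f i x *m (riem_mx i a b x)^T =
  B0 *: (grad f i x 0 a *: row b (g i x) - grad f i x 0 b *: row a (g i x)).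
Proof.
move=> [sf e] d; apply/rowP => c.
have sf' := smooth_fun_near sf d.
have := @ricci_identity (grad f) i x a b c d (smooth_grad G sf').
have gs k l : g i x k l = g i x l k by rewrite -[in LHS](tr_metric g_metric d) mxE.
have /eqP := e i x d a b c; have /eqP := e i x d b a c.
rewrite !addr_eq0 => /eqP -> /eqP -> /(congr1 -%R); rewrite [RHS]opprK => <-.
rewrite (gs c a) (gs c b) (gs b a).
move: (grad f i x) => m; rewrite !mxE; ring.
Qed.

(** Skewness moves the curvature from the 1-form to the raised vector at the cost of a sign. *)
Lemma raise_riem B0 f i x a b : got_solution g G B0 f -> dom A i x ->
  raise g i x (grad f i x) *m riem_mx i a b x =
  B0 *: (grad f i x 0 b *: delta_mx 0 a - grad f i x 0 a *: delta_mx 0 b).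
Proof.
move=> sol d; have gU := metric_unit g_metric d.
have sk : riem_mx i a b x *m g i x = - (g i x *m (riem_mx i a b x)^T).
  by apply/eqP; rewrite -addr_eq0 (riem_mx_skew g_metric G_LC a b d)//.
have -> : raise g i x (grad f i x) *m riem_mx i a b x =
    - (grad f i x *m (riem_mx i a b x)^T *m invmx (g i x)).
  rewrite /raise -[X in _ *m X](mulmxK gU) sk mulNmx mulmxN.
  by rewrite -!mulmxA (mulmxA (invmx _) (g i x)) mulVmx// mul1mx.
rewrite (got_riem a b sol d) -scalemxAl mulmxBl -!scalemxAl -!row_mul mulmxV//.
by rewrite -scalerN opprB !row1.
Qed.

Lemma schouten_sym i x p k : dom A i x -> schouten G i p k x = schouten G i k p x.
Proof. by move=> d; rewrite /schouten (ricci_sym g_metric G_LC)//. Qed.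

Lemma ricci_mul i x (v : 'rV[R]_n) k :
  \sum_p ricci G i p k x * v 0 p = \sum_a (v *m riem_mx i a k x) 0 a.
Proof.
rewrite /ricci; under eq_bigr do rewrite mulr_suml.
rewrite exchange_big; apply: eq_bigr => a _; rewrite mxE.
by apply: eq_bigr => p _; rewrite mxE mulrC.
Qed.

(** The first index of P is contracted, as in [weyl]; [is_Bg] contracts the second one, and
    [schouten_sym] reconciles the two. *)
Definition schouten_mul i x (v : 'rV[R]_n) k := \sum_p schouten G i p k x * v 0 p.

(** The trace of [raise_riem] has [n] equal terms minus one, and the resulting factor n-1 cancels
    the normalisation of the Schouten tensor. *)
Lemma schouten_raise B0 f i x k : got_solution g G B0 f -> dom A i x ->
  schouten_mul i x (raise g i x (grad f i x)) k = B0 * grad f i x 0 k.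
Proof.
move=> sol d; rewrite /schouten_mul /schouten; under eq_bigr do rewrite -mulrA.
rewrite -mulr_sumr ricci_mul; under eq_bigr do rewrite (raise_riem _ _ sol d).
move: (grad f i x) => m.
have -> : \sum_a (B0 *: (m 0 k *: delta_mx 0 a - m 0 a *: delta_mx 0 k) : 'rV_n) 0 a
    = B0 * (\sum_(a < n) m 0 k - m 0 k).
  under eq_bigr do rewrite !mxE !eqxx /= mulr1.
  rewrite -mulr_sumr sumrB; congr (_ * (_ - _)).
  rewrite (bigD1 k)//= eqxx mulr1 big1 ?addr0// => a ak.
  by rewrite (negPf ak) mulr0.
rewrite sumr_const card_ord -mulr_natl.
have n1 : (n%:R - 1 : R) != 0.
  by rewrite subr_eq0 -[1]/(1%:R) eqr_nat gtn_eqF.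
by field.
Qed.

Lemma weyl_mul i x (v : 'rV[R]_n) e k l :
  \sum_p weyl G i e p k l x * v 0 p = (v *m riem_mx i k l x) 0 e
    + (e == l)%:R * schouten_mul i x v k - (e == k)%:R * schouten_mul i x v l.
Proof.
rewrite /schouten_mul !mulr_sumr mxE -big_split -sumrB /=; apply: eq_bigr => p _.
by rewrite /weyl mxE; ring.
Qed.

Lemma raise_nullity B0 f i x : got_solution g G B0 f -> dom A i x ->
  nullity G i x (raise g i x (grad f i x)).
Proof.
move=> sol d e k l; rewrite weyl_mul (raise_riem _ _ sol d) !(schouten_raise _ sol d).
by move: (grad f i x) => m; rewrite !mxE eqxx /=; ring.
Qed.

Lemma nullity_eigen B0 f i x (w : 'rV[R]_n) k : got_solution g G B0 f ->
  dom A i x -> grad f i x != 0 -> nullity G i x w ->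
  schouten_mul i x w k = B0 * (w *m g i x) 0 k.
Proof.
move=> sol d df0 wN.
pose q := schouten_mul i x w; set m := grad f i x in df0 *; set u := w *m g i x.
(* For a nullity vector the Weyl tensor drops out, and the curvature is expressed by [q], the
   contraction of P with [w]. *)
have wR a b : w *m riem_mx i a b x = q b *: delta_mx 0 a - q a *: delta_mx 0 b.
  apply/rowP => e; have := wN e a b; rewrite weyl_mul => h.
  apply/eqP; rewrite -subr_eq0 -[X in _ == X]h !mxE !eqxx /=; apply/eqP.
  by rewrite /q; ring.
have pair (t : 'cV[R]_n) a b :
    ((q b *: delta_mx 0 a - q a *: delta_mx 0 b : 'rV[R]_n) *m t) 0 0 =
    q b * t a 0 - q a * t b 0.
  by rewrite mulmxBl -!scalemxAl -!rowE !mxE.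
(* The pairing of the curvature on [w] with the gradient is computed from [wR] and again from
   [got_riem]; hence [q - B0 u] is proportional to [m]. *)
have h1 a b : m 0 a * (q b - B0 * u 0 b) = m 0 b * (q a - B0 * u 0 a).
  have := pair m^T a b; rewrite -wR -mulmxA.
  rewrite -[riem_mx i a b x *m m^T]trmxK trmx_mul trmxK (got_riem a b sol d) -/m.
  have -> : (B0 *: (m 0 a *: row b (g i x) - m 0 b *: row a (g i x)))^T =
      B0 *: (m 0 a *: col b (g i x) - m 0 b *: col a (g i x)).
    rewrite [LHS]linearZ linearB /= !linearZ /=.
    by rewrite !tr_row (tr_metric g_metric d).
  rewrite -scalemxAr mulmxBr -!scalemxAr !colE !mulmxA -!colE -/u !mxE => h.
  exact: pair_cancel h.
(* The pairing with [w] itself vanishes by skewness, so [u] and [q] are proportional. *)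
have h2 a b : u 0 a * q b = u 0 b * q a.
  have := pair u^T a b; rewrite -wR /u trmx_mul (tr_metric g_metric d).
  have -> : w *m riem_mx i a b x *m (g i x *m w^T) =
      w *m (riem_mx i a b x *m g i x) *m w^T by rewrite !mulmxA.
  have z : (w *m (riem_mx i a b x *m g i x) *m w^T) 0 0 = 0.
    set Z := w *m _ *m _.
    have ZT : Z^T = - Z.
      rewrite /Z !trmx_mul trmxK (tr_metric g_metric d).
      have /eqP := riem_mx_skew g_metric G_LC a b d; rewrite addr_eq0 => /eqP ->.
      by rewrite mulmxN mulNmx opprK mulmxA.
    have /eqP : Z 0 0 = - Z 0 0 by rewrite -[in LHS](trmxK Z) ZT !mxE.
    by rewrite -addr_eq0 -mulr2n mulrn_eq0 => /eqP.
  rewrite z -[g i x *m w^T]trmxK trmx_mul trmxK (tr_metric g_metric d) -/u !mxE => h.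
  by move/eqP: h; rewrite eq_sym subr_eq0 => /eqP h; rewrite mulrC h mulrC.
have [k0 mk0] := rV0Pn _ df0.
(* If [q - B0 u] vanishes at an index where [m] does not, then it vanishes at every index by
   [h1]. *)
have [dk0|dk0] := eqVneq (q k0 - B0 * u 0 k0) 0.
  have /eqP := h1 k0 k; rewrite dk0 mulr0 mulf_eq0 (negPf mk0) /= subr_eq0.
  by move=> /eqP.
(* Otherwise [h1] and [h2] force [u] to be a multiple of [m], so [w] is a multiple of the raised
   gradient and [schouten_raise] applies. *)
have um a : u 0 a = u 0 k0 / m 0 k0 * m 0 a.
  have h3 : u 0 a * (q k0 - B0 * u 0 k0) = u 0 k0 * (q a - B0 * u 0 a).
    by rewrite !mulrBr (h2 a k0); ring.
  apply: (mulIf dk0); rewrite h3; apply: (mulfI mk0).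
  rewrite mulrCA (h1 k0 a); field; exact: mk0.
have -> : w = (u 0 k0 / m 0 k0) *: raise g i x m.
  rewrite /raise scalemxAl; apply: (canRL (mulmxK (metric_unit g_metric d))).
  by apply/rowP => a; rewrite [RHS]mxE -um.
rewrite (um k) mulrCA -(schouten_raise k sol d) /schouten_mul mulr_sumr.
by apply: eq_bigr => p _; rewrite mxE mulrCA.
Qed.

Lemma got_is_Bg B0 f x : got_solution g G B0 f ->
  (forall i, dom A i x -> grad f i x != 0) -> is_Bg g G x B0.
Proof.
move=> sol df0; split=> [i d|i d v vN e].
  exists (raise g i x (grad f i x)); first exact: raise_nullity sol d.
  apply: contra_neq (df0 i d) => /(congr1 (mulmx^~ (g i x))).
  by rewrite /raise mulmxKV ?metric_unit// mul0mx.
under eq_bigr do rewrite mulr_suml; rewrite exchange_big /=.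
under eq_bigr => k _ do (under eq_bigr do rewrite (schouten_sym _ _ d) -mulrA;
  rewrite -mulr_sumr -/(schouten_mul i x v k) (nullity_eigen k sol d (df0 i d) vN)).
have gU := metric_unit g_metric d.
under eq_bigr do rewrite mulrCA; rewrite -mulr_sumr; congr (_ * _).
rewrite -[in RHS](mulmxK gU v) [RHS]mxE; apply: eq_bigr => k _.
have -> : invmx (g i x) e k = invmx (g i x) k e.
  by rewrite -[in LHS](tr_metric g_metric d) -trmx_inv mxE.
exact: mulrC.
Qed.

(** [nullity_at] supplies a nonzero eigenvector, which determines its eigenvalue; so the choice made
    in [Bg] is forced. *)
Lemma is_Bg_inj x B0 B1 : is_Bg g G x B0 -> is_Bg g G x B1 -> B0 = B1.
Proof.
move=> [N0 h0] [_ h1]; have [i d] := dom_cover A x; have [v vN v0] := N0 i d.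
have [k vk] := rV0Pn _ v0.
by apply: (mulIf vk); rewrite -(h0 i d v vN k) -(h1 i d v vN k).
Qed.

Lemma Bg_eq x B0 : is_Bg g G x B0 -> Bg g G x = B0.
Proof.
move=> h; apply: (@is_Bg_inj x _ _ _ h).
exact: (@getPex _ [set b | is_Bg g G x b] (ex_intro _ B0 h)).
Qed.

End Nullity.

(** * Splitting of the cotractor bundle *)

Section CotractorSplitting.
Context {R : realType} {n : nat} {M : topologicalType}.
Context {A : smooth_atlas R n M}.
Variables (g : idx A -> M -> 'M[R]_n) (G : idx A -> 'I_n -> 'I_n -> 'I_n -> M -> R).
Hypotheses (g_metric : metric g) (G_LC : levi_civita g G).
Implicit Types (i j : idx A) (x : M) (a b c e : 'I_n) (f : M -> R).

Local Notation tau := (tau_g g).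
Local Notation conn_col i x := (\col_b conn1 G i b x).

Lemma det_jac_neq0 i j x : dom A i x -> dom A j x -> \det (jac i j x) != 0.
Proof.
move=> di dj; have := congr1 determinant (jacK di dj).
rewrite det_mulmx det1 => e; apply/eqP => z; move/eqP: e.
by rewrite z mul0r eq_sym oner_eq0.
Qed.

Lemma dens2 i j x : dom A i x -> dom A j x ->
  dens 2 i j x = dens 1 i j x * dens 1 i j x.
Proof.
move=> di dj; rewrite /dens -powRD; first by congr powR; field.
by apply/implyP => _; rewrite normr_eq0 det_jac_neq0.
Qed.

Lemma dens1_neq0 i j x : dom A i x -> dom A j x -> dens 1 i j x != 0.
Proof.
by move=> di dj; rewrite gt_eqF// powR_gt0// normr_gt0 det_jac_neq0.
Qed.

Lemma smooth_dens w i j x : dom A i x -> dom A j x -> smooth_near i x (dens w i j).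
Proof.
move=> di dj; apply: smooth_near_powR => //; first exact: det_jac_neq0.
apply: smooth_near_det => // a b; exact: smooth_near_jac.
Qed.

(* Differentiate tau_i = dens^2 tau_j, both tau_i and tau_j being parallel. *)
Lemma pd_dens1 i j x a : dom A i x -> dom A j x ->
  pd i a (dens 1 i j) x =
  dens 1 i j x * (\sum_b jac i j x a b * conn1 G j b x - conn1 G i a x).
Proof.
move=> di dj; have sd := smooth_dens 1 di dj; have d0 := dens1_neq0 di dj.
have [st pt] := smooth_near_chart di dj (smooth_tau_g g_metric dj).
have tauE : \forall y \near x, tau i y = dens 1 i j y * dens 1 i j y * tau j y.
  apply: filterS2 (near_dom di) (near_dom dj) => y dyi dyj.
  by rewrite (tau_g_trans g_metric dyi dyj) dens2.
have := pd_tau_g g_metric G_LC a di.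
rewrite (nbhs_singleton tauE) (pd_near_eq a di tauE).
rewrite (pdM a di (smooth_nearM sd sd) st) (pdM a di sd sd) pt.
under eq_bigr do rewrite (pd_tau_g g_metric G_LC)// mulrN.
have -> : \sum_b - (jac i j x a b * (2 * conn1 G j b x * tau j x)) =
    - (2 * tau j x * \sum_b jac i j x a b * conn1 G j b x).
  by rewrite mulr_sumr sumrN; congr (- _); apply: eq_bigr => b _; ring.
have t0 : tau j x != 0 by rewrite gt_eqF// tau_g_gt0.
move: (\sum_b _) (dens 1 i j x) (pd i a _ x) (tau j x) (conn1 G i a x) d0 t0.
move=> S d D t w d0 t0 e.
(* The differentiated identity is the claim multiplied by this nonzero factor. *)
have k0 : 2 * d * t != 0 by rewrite !mulf_neq0// pnatr_eq0.
apply: (mulfI k0).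
by apply/eqP; rewrite -subr_eq0; move/eqP: e; rewrite -subr_eq0 => /eqP <-;
  apply/eqP; ring.
Qed.

Definition split_inv i x : 'M[R]_(1 + n) := block_mx 1%:M 0 (- conn_col i x) 1%:M.

Lemma split_invK i x : split_inv i x *m split_mx G i x = 1%:M.
Proof.
rewrite /split_inv /split_mx mulmx_block !mul0mx !mulmx0 !mulmx1 !mul1mx.
by rewrite !addr0 add0r addNr -scalar_mx_block.
Qed.

Lemma split_mxK i x : split_mx G i x *m split_inv i x = 1%:M.
Proof. exact: mulmx1C (split_invK i x). Qed.

(** The transition matrix of the direct sum of E(1) and T*M(1). *)
Definition weight_mx i j x : 'M[R]_(1 + n) :=
  block_mx (dens 1 i j x)%:M 0 0 (dens 1 i j x *: jac i j x).

(** Only the lower left block has content, and there the equation is [pd_dens1]. *)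
Lemma split_jet_trans i j x : dom A i x -> dom A j x ->
  split_mx G i x *m jet_trans i j x = weight_mx i j x *m split_mx G j x.
Proof.
move=> di dj; rewrite /split_mx /jet_trans /weight_mx !mulmx_block.
rewrite !mul0mx !mulmx0 !mulmx1 !mul1mx !addr0 !add0r; congr block_mx.
apply/colP => a; rewrite mul_mx_scalar -scalemxAl !mxE (pd_dens1 a di dj).
rewrite mulrBr addrC subrK; congr (_ * _).
by apply: eq_bigr => b _; rewrite !mxE.
Qed.

Lemma jet_transE i j x : dom A i x -> dom A j x ->
  jet_trans i j x = split_inv i x *m weight_mx i j x *m split_mx G j x.
Proof.
by move=> di dj; rewrite -mulmxA -split_jet_trans// mulmxA split_invK mul1mx.
Qed.

(** Each factor [weight_mx] contributes weight 1, so all three components of the symmetric square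
    have weight 2. *)
Lemma weight_block i j x t (m : 'rV[R]_n) r :
  weight_mx i j x *m block_mx t%:M m m^T r *m (weight_mx i j x)^T =
  block_mx (dens 1 i j x * dens 1 i j x * t)%:M
    ((dens 1 i j x * dens 1 i j x) *: (m *m (jac i j x)^T))
    ((dens 1 i j x * dens 1 i j x) *: (m *m (jac i j x)^T))^T
    ((dens 1 i j x * dens 1 i j x) *: (jac i j x *m r *m (jac i j x)^T)).
Proof.
have JT : (dens 1 i j x *: jac i j x)^T = dens 1 i j x *: (jac i j x)^T.
  by rewrite linearZ.
rewrite /weight_mx tr_block_mx JT !trmx0 !mulmx_block !mul0mx !mulmx0 !addr0 !add0r.
rewrite tr_scalar_mx.
move: (dens 1 i j x) (jac i j x) {JT} => d J.
congr block_mx.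
- by rewrite -!scalar_mxM; congr (_%:M); ring.
- by rewrite mul_scalar_mx -scalemxAl -scalemxAr scalerA.
- by rewrite mul_mx_scalar -scalemxAl scalerA linearZ /= trmx_mul trmxK.
- by rewrite -scalemxAr -!scalemxAl scalerA.
Qed.

(** * Symmetric matrices and triples of components *)

Definition split_sym (H : idx A -> M -> 'M[R]_(1 + n)) i x : 'M[R]_(1 + n) :=
  split_mx G i x *m H i x *m (split_mx G i x)^T.

Definition join (s : triple A) i x : 'M[R]_(1 + n) :=
  block_mx (s.1.1 i x)%:M (s.1.2 i x) (s.1.2 i x)^T (s.2 i x).

Definition unsplit (s : triple A) i x : 'M[R]_(1 + n) :=
  split_inv i x *m join s i x *m (split_inv i x)^T.

(** [cotractor_split] discards the lower left block, which symmetry of [H] recovers from the upper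
    right one. *)
Lemma join_split H i x : (H i x)^T = H i x ->
  join (cotractor_split G H) i x = split_sym H i x.
Proof.
move=> HT; rewrite /join /= -/(split_sym H i x).
rewrite -[RHS](@submxK _ 1 n 1 n) [X in _ = block_mx X _ _ _]mx11_scalar.
congr block_mx; rewrite trmx_ursub; congr dlsubmx.
by rewrite /split_sym !trmx_mul trmxK HT mulmxA.
Qed.

Lemma split_join s H : (forall i x, split_sym H i x = join s i x) ->
  cotractor_split G H = s.
Proof.
case: s => [[t m] r] E; rewrite /cotractor_split /=.
congr (_, _, _); apply/funext => i; apply/funext => x;
  rewrite -/(split_sym H i x) E /join /=.
- by rewrite block_mxKul mxE.
- by rewrite block_mxKur.
- by rewrite block_mxKdr.
Qed.

Lemma split_unsplit s : cotractor_split G (unsplit s) = s.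
Proof.
apply: split_join => i x; rewrite /split_sym /unsplit !mulmxA split_mxK mul1mx.
by rewrite -mulmxA -trmx_mul split_mxK trmx1 mulmx1.
Qed.

Lemma unsplit_split H : (forall i x, (H i x)^T = H i x) ->
  unsplit (cotractor_split G H) = H.
Proof.
move=> HT; apply/funext => i; apply/funext => x; rewrite /unsplit join_split//.
rewrite /split_sym !mulmxA split_invK mul1mx.
by rewrite -mulmxA -trmx_mul split_invK trmx1 mulmx1.
Qed.

Lemma smooth_conn_col i x : dom A i x -> smooth_mx i x (fun y => conn_col i y).
Proof.
move=> d b c; under eq_fun do rewrite mxE /conn1.
apply: smooth_nearM; last exact: smooth_near_cst.
by apply: smooth_near_sum => // k _; exact: (smooth_christoffel G_LC).
Qed.

Lemma smooth_split_mx i x : dom A i x -> smooth_mx i x (split_mx G i).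
Proof.
move=> d; apply: smooth_mx_block; try exact: smooth_mx_cst.
exact: smooth_conn_col.
Qed.

Lemma smooth_split_inv i x : dom A i x -> smooth_mx i x (split_inv i).
Proof.
move=> d; apply: smooth_mx_block; try exact: smooth_mx_cst.
by move=> b c; under eq_fun do rewrite mxE; apply: smooth_nearN => //;
  exact: smooth_conn_col.
Qed.

Definition sections (s : triple A) : Prop :=
  [/\ Esec 2 s.1.1, T1sec 2 s.1.2 & S2sec 2 s.2].

Lemma join_trans s i j x : sections s -> dom A i x -> dom A j x ->
  join s i x = weight_mx i j x *m join s j x *m (weight_mx i j x)^T.
Proof.
move=> [[_ tt _] [_ mt _] [_ _ rt _]] di dj; rewrite /join weight_block -dens2//.
by rewrite (tt i j)// (mt i j)// (rt i j).
Qed.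

Lemma sections_unsplit s : sections s -> S2Tsec (unsplit s).
Proof.
move=> sec; have [[st tt t0] [sm mt m0] [sr rT rt r0]] := sec.
split=> [i a b|i x|i j x di dj|i x d].
- apply/smooth_onP => x d; have si := smooth_split_inv d.
  apply: smooth_mxM => //; last exact: smooth_mxT.
  apply: smooth_mxM => //; apply: smooth_mx_block.
  + move=> k l; under eq_fun do rewrite !ord1 mxE mulr1n.
    exact: (iffLR (smooth_onP _ _) (st i)).
  + by move=> k l; rewrite ord1; exact: (iffLR (smooth_onP _ _) (sm i l)).
  + apply: smooth_mxT => k l; rewrite ord1.
    exact: (iffLR (smooth_onP _ _) (sm i l)).
  + by move=> k l; exact: (iffLR (smooth_onP _ _) (sr i k l)).
- rewrite /unsplit !trmx_mul trmxK mulmxA /join tr_block_mx.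
  by rewrite tr_scalar_mx trmxK rT.
(* The splitting matrices of chart [j] cancel between [jet_trans] and [unsplit]. *)
- rewrite (jet_transE di dj) {1}/unsplit (join_trans sec di dj).
  rewrite /unsplit !trmx_mul !mulmxA.
  rewrite -[_ *m split_mx G j x *m split_inv j x]mulmxA split_mxK mulmx1.
  rewrite -[_ *m (split_inv j x)^T *m (split_mx G j x)^T]mulmxA -trmx_mul split_mxK.
  by rewrite trmx1 mulmx1.
- rewrite /unsplit /join t0// m0// r0// trmx0 raddf0.
  by rewrite (_ : block_mx _ _ _ _ = 0) ?mulmx0 ?mul0mx// -block_mx0.
Qed.

Lemma sections_split H : S2Tsec H -> sections (cotractor_split G H).
Proof.
move=> [sH HT Ht H0].
have sK i x : dom A i x -> smooth_mx i x (split_sym H i).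
  move=> d; have ss := smooth_split_mx d.
  apply: smooth_mxM => //; last exact: smooth_mxT.
  by apply: smooth_mxM => // b c; exact: (iffLR (smooth_onP _ _) (sH i b c)).
have K0 i x : ~ dom A i x -> split_sym H i x = 0.
  by move=> d; rewrite /split_sym H0// mulmx0 mul0mx.
have KT i x : (split_sym H i x)^T = split_sym H i x.
  by rewrite /split_sym !trmx_mul trmxK HT mulmxA.
(* After the splitting the transition matrices are block diagonal, so the laws of the three
   components can be read off separately. *)
have Kt i j x : dom A i x -> dom A j x -> join (cotractor_split G H) i x =
    weight_mx i j x *m join (cotractor_split G H) j x *m (weight_mx i j x)^T.
  move=> di dj; rewrite !join_split// {1}/split_sym (Ht i j)// (jet_transE di dj).
  rewrite /split_sym !trmx_mul !mulmxA split_mxK mul1mx.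
  rewrite -[_ *m (split_inv i x)^T *m (split_mx G i x)^T]mulmxA -trmx_mul split_mxK.
  by rewrite trmx1 mulmx1.
have {}Kt i j x : dom A i x -> dom A j x -> [/\
    (cotractor_split G H).1.1 i x = dens 2 i j x * (cotractor_split G H).1.1 j x,
    (cotractor_split G H).1.2 i x =
      dens 2 i j x *: ((cotractor_split G H).1.2 j x *m (jac i j x)^T) &
    (cotractor_split G H).2 i x =
      dens 2 i j x *: (jac i j x *m (cotractor_split G H).2 j x *m (jac i j x)^T)].
  move=> di dj; have := Kt i j x di dj; rewrite {2}/join weight_block -dens2//.
  move=> /eq_block_mx[e1 e2 _ e4]; split=> //.
  by move/matrixP: e1 => /(_ 0 0); rewrite !mxE.
split; split.
- move=> i; apply/smooth_onP => x d.
  suff -> : (cotractor_split G H).1.1 i =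
      (fun y => split_sym H i y (lshift n 0) (lshift n 0)) by exact: sK.
  by apply/funext => y; rewrite [LHS]mxE [LHS]mxE.
- by move=> i j x di dj; have [] := Kt i j x di dj.
- by move=> i x d; rewrite /= -/(split_sym H i x) K0// !mxE.
- move=> i a; apply/smooth_onP => x d.
  suff -> : (fun y => (cotractor_split G H).1.2 i y 0 a) =
      (fun y => split_sym H i y (lshift n 0) (rshift 1 a)) by exact: sK.
  by apply/funext => y; rewrite [LHS]mxE [LHS]mxE.
- by move=> i j x di dj; have [] := Kt i j x di dj.
- by move=> i x d; rewrite /= -/(split_sym H i x) K0//;
    apply/matrixP => k l; rewrite !mxE.
- move=> i a b; apply/smooth_onP => x d.
  suff -> : (fun y => (cotractor_split G H).2 i y a b) =
      (fun y => split_sym H i y (rshift 1 a) (rshift 1 b)) by exact: sK.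
  by apply/funext => y; rewrite [LHS]mxE [LHS]mxE.
- by move=> i x; rewrite /= -/(split_sym H i x) trmx_drsub KT.
- by move=> i j x di dj; have [] := Kt i j x di dj.
- by move=> i x d; rewrite /= -/(split_sym H i x) K0//;
    apply/matrixP => k l; rewrite !mxE.
Qed.

(** With [Bg] constant the components of [nabla_T1] are literally the left-hand sides of the system;
    the substance is that the components of [H] are sections of the weighted bundles. *)
Lemma T1_parallelP B0 H : (forall x, Bg g G x = B0) ->
  T1_parallel g G H <-> S2Tsec H /\ system_solution g G B0 (cotractor_split G H).
Proof.
move=> BgE; rewrite /T1_parallel /nabla_T1.
split=> [[sH e]|[sH e]]; split=> //.
  have [st sm sr] := sections_split sH.
  move: e st sm sr; case: (cotractor_split G H) => [[t m] r] /= e st sm sr.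
  split=> // i x d; split=> [a|a b|a b c]; have := e i x d a; rewrite BgE => -[].
  - by [].
  - by move=> _ /rowP/(_ b); rewrite !mxE.
  - by move=> _ _ /matrixP/(_ b c); rewrite !mxE.
move=> i x d a; rewrite BgE.
move: e; case: (cotractor_split G H) => [[t m] r] /= [_ _ _ e].
have [e1 e2 e3] := e i x d; congr (_, _, _); first exact: e1.
  by apply/rowP => b; rewrite [LHS]mxE e2 mxE.
by apply/matrixP => b c; rewrite [LHS]mxE e3 mxE.
Qed.

Lemma got_parallel_one_to_one B0 : (forall x, Bg g G x = B0) ->
  one_to_one (got_solution g G B0) (T1_parallel g G)
    (fun f H => corresponds g f (cotractor_split G H).1.1).
Proof.
move=> BgE; have [h1 h2] := got_system_one_to_one g_metric G_LC B0.
split=> [f /h1[s [[ss fs] us]]|H /(T1_parallelP _ BgE)[sH ss]]; last exact: h2.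
have sec : sections s by case: s ss {fs us} => [[t m] r] [].
exists (unsplit s); split.
  split; last by rewrite split_unsplit.
  by apply/(T1_parallelP _ BgE); rewrite split_unsplit; split=> //;
    exact: sections_unsplit.
move=> H [/(T1_parallelP _ BgE)[sH sol] fH].
rewrite (us (cotractor_split G H))//; apply: unsplit_split.
by case: sH.
Qed.

End CotractorSplitting.

Theorem theorem3p24 (R : realType) (n : nat) (n_ge2 : (2 <= n)%N)
    (M : topologicalType) (X : smooth_manifold R n M)
    (g : idx X -> M -> 'M[R]_n) (g_metric : metric g)
    (G : idx X -> 'I_n -> 'I_n -> 'I_n -> M -> R) (G_LC : levi_civita g G) :
  (forall B0 : R,
     one_to_one (got_solution g G B0) (system_solution g G B0)
       (fun f s => corresponds g f s.1.1) /\
     (forall f : M -> R, got_solution g G B0 f ->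
      forall U : set M, open U ->
        (forall x i, U x -> dom X i x -> nabla0 G 2 (tau_of g f) i x != 0) ->
        forall x, U x ->
          (forall i, dom X i x ->
             nullity G i x (raise g i x (nabla0 G 2 (tau_of g f) i x))) /\
          is_Bg g G x B0 /\ Bg g G x = B0)) /\
  (forall B0 : R,
     has_weyl_nullity G -> (forall x, Bg g G x = B0) ->
     one_to_one (got_solution g G B0) (T1_parallel g G)
       (fun f H => corresponds g f (cotractor_split G H).1.1)).
Proof.
split=> [B0|B0 _ BgE]; last exact: got_parallel_one_to_one.
split=> [|f sol U _ Unz x Ux]; first exact: got_system_one_to_one.
(* As [tau_g] is parallel and positive, the weighted gradient is a positive multiple of the gradient
   of [f]; nonvanishing and nullity can thus be transferred between the two. *)
have tauE i : dom X i x -> nabla0 G 2 (tau_of g f) i x =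
    tau_g g i x *: nabla0 G 0 (fun=> f) i x.
  move=> d; apply: (nabla0_tau g_metric G_LC d); apply: smooth_fun_near d.
  by case: sol.
have df0 i : dom X i x -> nabla0 G 0 (fun=> f) i x != 0.
  by move=> d; have := Unz x i Ux d; rewrite tauE// scaler_eq0 negb_or => /andP[].
have isB : is_Bg g G x B0 by exact: got_is_Bg sol df0.
split=> [i d|]; last by split=> //; exact: Bg_eq.
rewrite tauE// /raise -scalemxAl => e k l.
transitivity (tau_g g i x * \sum_p weyl G i e p k l x *
    raise g i x (nabla0 G 0 (fun=> f) i x) 0 p).
  by rewrite mulr_sumr; apply: eq_bigr => p _; rewrite [X in _ * X]mxE mulrCA.
by rewrite (raise_nullity g_metric G_LC n_ge2 sol d) mulr0.
Qed.
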